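(* Let $k\geq 1$ be a fixed integer. Then for every $\varepsilon>0$ there exists $\Delta_0$ such that for every $\Delta\geq\Delta_0$, all graphs $G_1,\dots,G_k$ of maximum degree at most $\Delta$ satisfy $\chi'(G_1,\dots,G_k)\leq \nu(k)\Delta+\varepsilon\Delta$ (that is, $\chi'(G_1,\dots,G_k)\leq \nu(k)\Delta+o(\Delta)$). Furthermore, for every positive integer $\Delta$ there exist stars $G_1,\dots,G_k$, all with the same centre vertex and each having exactly $\Delta$ edges (i.e. $\Delta$-regular stars), such that $\chi'(G_1,\dots,G_k)\geq \nu(k)\Delta-k$.
   Context: Graphs are finite and simple; $G_1,\dots,G_k$ may share vertices and edges. An edge-colouring of $G_1\cup\dots\cup G_k$ is simultaneously proper if its restriction to each $G_i$ is proper (no two incident edges of $G_i$ get the same colour). The simultaneous chromatic index $\chi'(G_1,\dots,G_k)$ is the least number of colours in a simultaneously proper edge-colouring of $G_1\cup\dots\cup G_k$. A hypergraph $H$ has a vertex set and a set of edges, each edge a set of vertices; it is intersecting if every two edges share a vertex. A fractional matching of $H$ is a function $w\colon E(H)\to[0,1]$ with $\sum_{e\ni v}w(e)\leq 1$ for every vertex $v$; its size is $\sum_{e}w(e)$, and $\nu^*(H)$ is the maximum size of a fractional matching of $H$. The function $\nu(k)$ is the maximum of $\nu^*(H)$ over all intersecting hypergraphs $H$ on $k$ vertices. *)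

(* Defs.v *)
From HB Require Import structures.
From mathcomp Require Import all_boot all_order all_algebra.
From mathcomp Require Import classical_sets reals.

Set Implicit Arguments.
Unset Strict Implicit.
Unset Printing Implicit Defensive.

Import Order.TTheory GRing.Theory Num.Theory.

Local Open Scope ring_scope.

(* A finite simple graph whose vertex set is a subset of an ambient finite type
   [T], so that several graphs over the same [T] may share vertices and edges. *)
Record sgraph (T : finType) := SGraph {
  vertices : {set T};
  edges : {set {set T}};
  edges_wf : [forall e in edges, (e \subset vertices) && (#|e| == 2)]
}.

Section Graphs.
Variable T : finType.
Implicit Types (G : sgraph T) (v c : T).

Definition degree G v : nat := #|[set e in edges G | v \in e]|.

Definition max_degree G : nat := (\max_(v in vertices G) degree G v)%N.

Definition is_star c G : bool :=
  (c \in vertices G) &&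
  (edges G == [set [set c; v] | v in (vertices G :\ c)%SET]).

Section SimultaneousColouring.
Variables (k : nat) (Gs : 'I_k -> sgraph T).

Definition union_edges : {set {set T}} := (\bigcup_(i < k) edges (Gs i))%SET.

Definition union_edge : finType := {e : {set T} | e \in union_edges}.

Definition simultaneously_proper n (c : {ffun union_edge -> 'I_n}) : bool :=
  [forall i : 'I_k, forall e : union_edge, forall f : union_edge,
    [&& val e \in edges (Gs i), val f \in edges (Gs i), e != f
      & (val e :&: val f)%SET != finset.set0] ==> (c e != c f)].

Definition simultaneously_colourable (n : nat) : bool :=
  [exists c : {ffun union_edge -> 'I_n}, simultaneously_proper c].

Lemma simultaneously_colourable_ex : exists n, simultaneously_colourable n.
Proof.
exists #|union_edge|; apply/existsP; exists [ffun e => enum_rank e].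
apply/forallP => i; apply/forallP => e; apply/forallP => f.
apply/implyP => /and4P[_ _ nef _]; rewrite !ffunE.
by apply: contra nef => /eqP /enum_rank_inj ->.
Qed.

Definition simultaneous_chromatic_index : nat :=
  ex_minn simultaneously_colourable_ex.

End SimultaneousColouring.
End Graphs.

Section Hypergraphs.
Variables (R : realType) (V : finType).

(* A hypergraph with vertex set [V] is given by its set of edges. *)
Implicit Type H : {set {set V}}.

Definition intersecting H : bool :=
  [forall e in H, forall f in H, (e != f) ==> ((e :&: f)%SET != finset.set0)].

(* Values of [w] outside [H] are irrelevant. *)
Definition fractional_matching H (w : {set V} -> R) : Prop :=
  (forall e, e \in H -> 0 <= w e <= 1) /\
  (forall v, \sum_(e in H | v \in e) w e <= 1).

(* The sizes form a nonempty compact set of reals, so the supremum is the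
   maximum. *)
Definition fractional_matching_number H : R :=
  sup [set s | exists2 w, fractional_matching H w & s = \sum_(e in H) w e]%classic.

End Hypergraphs.

(* The default value 0 is harmless: fractional matching numbers are nonnegative
   and the hypergraph without edges is intersecting. *)
Definition nu (R : realType) (k : nat) : R :=
  \big[Num.max/0]_(H : {set {set 'I_k}} | intersecting H)
     fractional_matching_number R H.

(* Main.v *)
Require Import Defs.
From mathcomp Require Import classical_sets reals sequences exp.
From mathcomp Require Import all_boot all_order all_algebra.
From mathcomp Require Import zify ring lra.

(* The type of an edge [uv] is the set of indices [i] with [uv] in [G_i]; edges
   meeting in a vertex may share a colour exactly when their types are disjoint.

   Upper bound.  At one vertex, keep merging edges (later: families of edges)
   whose types are disjoint.  When this stops, the unions of types form an
   intersecting hypergraph, on which the multiplicities divided by [Delta] are a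
   fractional matching, so at most [nu k * Delta] families remain.  Rounding the
   number of edges of each type, this gives every vertex [u] a bounded number [q]
   of positions and a set [A u S] of positions for each type [S], of size
   proportional to the degree of [u] in type [S], with [A u S] and [A u S']
   disjoint when [S] and [S'] meet.

   To make the choices at the two ends of an edge independent, every vertex gets
   a label [(z, y)] in [Z/r * Z/q], and the colours are split into blocks indexed
   by [(th, a, b)] in [Z/r * Z/q * Z/q].  In such a block only edges [uv] with
   [z u < z v] and [z u + z v = th] are coloured, [u] uses its position [a + y u]
   and [v] its position [b + y v].  An edge of type [S] chooses a pair of positions
   in [A u S * A v S].  By the local lemma, the labels and these pairs can be chosen
   so that all degrees are close to their means under uniform random choices; then
   in each block every type induces a bipartite graph of small degree, which is
   coloured by Koenig's theorem.  The edges with [z u = z v] have small degree and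
   are coloured greedily.

   Lower bound.  A fractional matching of an intersecting hypergraph can be
   replaced by one supported on at most [k] edges without decreasing its size, by
   moving along linear dependencies between the incidence vectors of its support.
   Hence rounding [Delta * w] down to integers loses at most [k], and the resulting
   numbers of edges of each type, all at one vertex, are in pairwise conflict. *)

Set Implicit Arguments.
Unset Strict Implicit.
Unset Printing Implicit Defensive.

Import Order.TTheory GRing.Theory Num.Theory.

Local Open Scope ring_scope.

Local Notation set0 := finset.set0.

(** * The local lemma on a finite product space *)

Section ProductMeasure.
Variables (R : realFieldType) (V L : finType) (mu : V -> L -> R).
Hypothesis mu_ge0 : forall v l, 0 <= mu v l.
Hypothesis mu_sum1 : forall v, \sum_l mu v l = 1.
Implicit Types (A B : {set {ffun V -> L}}) (X : {set V}) (f g : {ffun V -> L}).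

Definition weight f : R := \prod_v mu v (f v).
Definition prob A : R := \sum_(f in A) weight f.

Lemma weight_ge0 f : 0 <= weight f.
Proof. exact: prodr_ge0. Qed.

Lemma prob_ge0 A : 0 <= prob A.
Proof. by apply: sumr_ge0 => f _; apply: weight_ge0. Qed.

Lemma expectation_prod (F : V -> L -> R) :
  \sum_f weight f * \prod_v F v (f v) = \prod_v \sum_l mu v l * F v l.
Proof.
by rewrite bigA_distr_bigA; apply: eq_bigr => f _; rewrite /weight big_split.
Qed.

Lemma probT : prob [set: {ffun V -> L}] = 1.
Proof.
rewrite /prob; under eq_bigl do rewrite inE.
rewrite /weight -(bigA_distr_bigA mu); exact: big1.
Qed.

Lemma prob_sub A B : A \subset B -> prob A <= prob B.
Proof.
move=> /subsetP sAB; rewrite /prob [leRHS](bigID (mem A)) /=.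
under [X in _ <= X + _]eq_bigl => f.
  rewrite (_ : _ && _ = (f \in A)); last by apply: andb_idl => /sAB.
over.
by rewrite lerDl; apply: sumr_ge0 => f _; apply: weight_ge0.
Qed.

Lemma probID A B : prob A = prob (A :&: B) + prob (A :\: B).
Proof.
rewrite /prob (bigID (mem B)) /=; congr (_ + _); apply: eq_bigl => f.
  by rewrite inE.
by rewrite inE andbC.
Qed.

Lemma probU A B : prob (A :|: B) <= prob A + prob B.
Proof.
rewrite (probID _ A) setUK lerD2l; apply: prob_sub.
by apply/subsetP => f; rewrite !inE; case: (f \in A).
Qed.

Lemma prob_bigcup (I : finType) (P : pred I) (F : I -> {set {ffun V -> L}}) :
  prob (\bigcup_(i | P i) F i) <= \sum_(i | P i) prob (F i).
Proof.
apply: (big_ind2 (fun A a => prob A <= a)) => //; first by rewrite /prob big_set0.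
by move=> A a B b hA hB; apply: le_trans (probU A B) _; apply: lerD.
Qed.

Definition determined X A :=
  forall f g, (forall v, v \in X -> f v = g v) -> (f \in A) = (g \in A).

Definition mix X f g : {ffun V -> L} := [ffun v => if v \in X then f v else g v].

Lemma mixK X f g : mix X (mix X f g) (mix X g f) = f.
Proof. by apply/ffunP => v; rewrite /mix !ffunE; case: (v \in X). Qed.

Lemma weight_mix X f g :
  weight (mix X f g) * weight (mix X g f) = weight f * weight g.
Proof.
rewrite /weight -!big_split; apply: eq_bigr => v _ /=.
by rewrite /mix !ffunE; case: (v \in X) => //; rewrite mulrC.
Qed.

(** Take two independent copies of the space: exchanging their coordinates outside [X] is a
    weight-preserving involution on pairs that turns the condition [A :&: B] on the first copy into
    [A] on the first and [B] on the second. *)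
Lemma prob_indep X A B : determined X A -> determined (~: X) B ->
  prob (A :&: B) = prob A * prob B.
Proof.
move=> detA detB.
rewrite -[LHS]mulr1 -probT /prob !big_distrlr /=.
rewrite !pair_big /=.
pose h (q : {ffun V -> L} * {ffun V -> L}) := (mix X q.1 q.2, mix X q.2 q.1).
have hK : involutive h by case=> f g; rewrite /h /= !mixK.
rewrite (reindex_inj (inv_inj hK)) /=.
apply: eq_big => [[f g]|[f g] _] /=; last exact: weight_mix.
rewrite !inE andbT; congr (_ && _).
  by apply: detA => v vX; rewrite /mix ffunE vX.
by apply: detB => v; rewrite inE /mix ffunE => /negbTE ->.
Qed.

(** The nonzero factors serve to keep every random choice inside the support of its distribution. *)
Lemma prob_gt0_ex A : 0 < prob A -> exists2 f, f \in A & forall v, mu v (f v) != 0.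
Proof.
move=> A0; have [/exists_inP[f fA wf]|/exists_inPn h] := boolP [exists f in A, weight f != 0].
  by exists f => // v; apply: contraNneq wf => fv; rewrite /weight (bigD1 v) //= fv mul0r.
by move: A0; rewrite /prob big1 ?ltxx // => f /h; rewrite negbK => /eqP.
Qed.

Section LocalLemma.
Variables (J : finType) (N : J -> {set V}) (B : J -> {set {ffun V -> L}}).
Variables (p : R) (d : nat).
Hypothesis detB : forall j, determined (N j) (B j).
Hypothesis probB : forall j, prob (B j) <= p.
Hypothesis depB : forall j, (#|[set i | ~~ [disjoint N i & N j]]| <= d)%N.
Hypothesis pd : 4 * p * d.+1%:R <= 1.

Let avoid (I : {set J}) : {set {ffun V -> L}} := [set f | [forall j in I, f \notin B j]].

Let avoidU1 j (I : {set J}) : avoid (j |: I) = avoid I :\: B j.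
Proof.
apply/setP => f; rewrite !inE; apply/forall_inP/andP => [h|[fj /forall_inP h] i].
  split; first by apply: h; rewrite setU11.
  by apply/forall_inP => i iI; apply: h; rewrite setU1r.
by case/setU1P => [->//|/h].
Qed.

Let avoidS (I I' : {set J}) : I \subset I' -> avoid I' \subset avoid I.
Proof.
move=> /subsetP sII; apply/subsetP => f; rewrite !inE => /forall_inP h.
by apply/forall_inP => i /sII /h.
Qed.

Let p_ge0 (j : J) : 0 <= p := le_trans (prob_ge0 (B j)) (probB j).

(** Induction on the size of [I], written without division. The events of [I] sharing no variable
    with [B j] form [I2] and are jointly independent of it. At most [d] events remain, each of
    conditional probability at most [2 * p] once [I2] is avoided, so avoiding them too at worst
    halves the probability. *)
Let lll_cond n (I : {set J}) j : (#|I| <= n)%N -> j \notin I ->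
  prob (avoid I :&: B j) <= 2 * p * prob (avoid I).
Proof.
elim: n I j => [|n IHn] I j.
all: move=> leI jI; have p0 := p_ge0 j.
all: pose I1 := [set i in I | ~~ [disjoint N i & N j]]; pose I2 := I :\: I1.
all: have sI2 : I2 \subset I by apply: subsetDl.
all: have indep : prob (avoid I2 :&: B j) <= p * prob (avoid I2).
1,3: rewrite setIC (@prob_indep (N j)) //; [by rewrite ler_wpM2r ?prob_ge0|].
1,2: move=> f g fg; rewrite !inE; apply: eq_forallb => i.
1,2: case: (boolP (i \in I2)) => //= iI2; congr (~~ _); apply: detB => v vi.
1,2: apply: fg; rewrite inE; apply/negP => vj; move: iI2; rewrite !inE negb_and negbK.
1,2: case/andP => /orP[/negP//|dij] _; move/pred0P: dij => /(_ v) /=; by rewrite vi vj.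
all: have le1 : prob (avoid I :&: B j) <= p * prob (avoid I2) by
       apply: le_trans indep; apply: prob_sub; apply: setSI; apply: avoidS.
  have /eqP I0 : I == set0 by rewrite -cards_eq0 -leqn0.
  have I20 : I2 = I by apply/eqP; rewrite eqEsubset sI2 I0 sub0set.
  apply: le_trans le1 _; rewrite I20; have := prob_ge0 (avoid I); nra.
suff half : prob (avoid I2) <= 2 * prob (avoid I).
  by apply: le_trans le1 _; rewrite [2 * p]mulrC -mulrA ler_wpM2l.
have [I10|[i0 i0I1]] := set_0Vmem I1.
  by rewrite /I2 I10 setD0; have := prob_ge0 (avoid I); lra.
have I2n : (#|I2| <= n)%N.
  rewrite -ltnS; apply: leq_trans leI; apply: proper_card; apply/properP; split=> //.
  exists i0; first by move: i0I1; rewrite inE => /andP[].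
  by rewrite inE i0I1.
have le2 : prob (avoid I2) <= prob (avoid I) + \sum_(i in I1) prob (avoid I2 :&: B i).
  apply: le_trans (_ : prob (avoid I :|: \bigcup_(i in I1) (avoid I2 :&: B i)) <= _).
    apply: prob_sub; apply/subsetP => f fI2; rewrite inE.
    case: (boolP (f \in avoid I)) => //=; rewrite inE negb_forall_in.
    case/exists_inP => i iI; rewrite negbK => fi; apply/bigcupP; exists i; last by rewrite inE fI2.
    apply: contraLR fi => iI1; move: fI2; rewrite inE => /forall_inP; apply.
    by rewrite inE iI1.
  apply: le_trans (probU _ _) _; rewrite lerD2l; exact: prob_bigcup.
have le3 : \sum_(i in I1) prob (avoid I2 :&: B i) <= \sum_(i in I1) 2 * p * prob (avoid I2).
  apply: ler_sum => i iI1; apply: IHn => //; by rewrite inE iI1.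
have dI1 : (#|I1| <= d)%N.
  by apply: leq_trans (depB j); apply: subset_leq_card; apply/subsetP => i; rewrite !inE => /andP[].
move: le3; rewrite sumr_const -mulr_natl => le3.
have : #|I1|%:R <= d.+1%:R :> R by rewrite ler_nat leqW.
have := prob_ge0 (avoid I2); set P2 := prob (avoid I2) in le2 le3 * => P20 le4.
have : p * #|I1|%:R <= p * d.+1%:R by rewrite ler_wpM2l.
move=> le5.
have : 4 * (p * #|I1|%:R) * P2 <= 1 * P2 by rewrite ler_wpM2r //; apply: le_trans pd; rewrite -mulrA ler_pM2l.
move: le2 le3; set Q := \sum_(i in I1) _; nra.
Qed.

Lemma local_lemma : exists2 f, forall j, f \notin B j & forall v, mu v (f v) != 0.
Proof.
suff pos n (I : {set J}) : (#|I| < n)%N -> 0 < prob (avoid I).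
  have /prob_gt0_ex[f + f0] := pos _ [set: J] (leqnn _); rewrite inE => /forall_inP h.
  by exists f => // j; apply: h; rewrite inE.
elim: n I => // n IHn I ltI.
have [->|[j jI]] := set_0Vmem I.
  rewrite (_ : avoid set0 = setT) ?probT //.
  by apply/setP => f; rewrite !inE; apply/forall_inP => j; rewrite inE.
rewrite -(setD1K jI) avoidU1.
have := IHn (I :\ j); rewrite (cardsD1 j I) jI ltnS in ltI * => /(_ ltI) pos.
have := @lll_cond _ (I :\ j) j (leqnn _); rewrite !inE eqxx /= => /(_ isT).
(* Avoiding one more event keeps at least the fraction [1 - 2 * p >= 1/2] of the probability. *)
have := probID (avoid (I :\ j)) (B j); have := p_ge0 j.
have : 4 * p * 1 <= 4 * p * d.+1%:R.
  by rewrite ler_wpM2l ?ler1n // mulr_ge0 // p_ge0.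
move: pos pd; set P := prob (avoid _); nra.
Qed.
End LocalLemma.
End ProductMeasure.

(** * Concentration *)

Section Concentration.
Variable R : realType.

(** Invert [expR (- y) >= 1 - y]; the product [(1 - y) * (1 + y + 2 * y ^+ 2)] is at least 1 for
    [0 <= y <= 1/2]. *)
Lemma expR_le_quadratic (y : R) : 0 <= y -> y <= 1/2 -> expR y <= 1 + y + 2 * y ^+ 2.
Proof.
move=> y0 y1; have := expR_ge1Dx (- y); rewrite expRN => h.
have := expR_gt0 y; have := mulVf (lt0r_neq0 (expR_gt0 y)).
by move: (expR y)^-1 h => i h; nra.
Qed.

(** Chernoff's argument: the indicator of the event is at most the exponential of [t] times the
    excess, whose expectation factorises over the coordinates in [N]. *)
Lemma prob_exceed_mean (V L : finType) (mu : V -> L -> R) (N : {set V})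
    (x : V -> L -> R) (t a : R) :
  (forall v l, 0 <= mu v l) -> (forall v, \sum_l mu v l = 1) ->
  (forall v l, 0 <= x v l <= 1) -> 0 <= t -> t <= 1/2 ->
  prob mu [set f : {ffun V -> L} |
      \sum_(v in N) \sum_l mu v l * x v l + a < \sum_(v in N) x v (f v)]
    <= expR (2 * t ^+ 2 * #|N|%:R - t * a).
Proof.
move=> mu0 mu1 x01 t0 t1; set E := \sum_(v in N) _.
set A := [set f | _].
pose F v l := if v \in N then expR (t * x v l) else 1.
have step1 : prob mu A <= \sum_f weight mu f * (expR (- t * (E + a)) * \prod_v F v (f v)).
  rewrite [leRHS](bigID (mem A)) /=; rewrite -[leLHS]addr0; apply: lerD; last first.
    apply: sumr_ge0 => f _; rewrite mulr_ge0 ?weight_ge0 // mulr_ge0 ?expR_ge0 //.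
    by apply: prodr_ge0 => v _; rewrite /F; case: ifP; rewrite ?expR_ge0.
  apply: ler_sum => f; rewrite inE => fA; rewrite ler_peMr ?weight_ge0 //.
  rewrite -big_mkcond /= -expR_sum -expRD.
  apply: le_trans (expR_ge1Dx _); rewrite lerDl -mulr_sumr mulNr addrC -mulrBr.
  by rewrite mulr_ge0 // subr_ge0 ltW.
apply: le_trans step1 _.
under eq_bigr do rewrite mulrCA.
rewrite -mulr_sumr expectation_prod.
apply: le_trans (_ : expR (- t * (E + a)) * expR (t * E + 2 * t ^+ 2 * #|N|%:R) <= _); last first.
  by rewrite -expRD ler_expR; lra.
rewrite ler_pM2l ?expR_gt0 // /E mulr_sumr mulr_natr -sumr_const -big_split /= expR_sum.
rewrite [leRHS]big_mkcond; apply: ler_prod => v _ /=; apply/andP; split.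
  apply: sumr_ge0 => l _; rewrite mulr_ge0 // /F; case: ifP => // _; exact: expR_ge0.
rewrite /F; case: (v \in N); last by under eq_bigr do rewrite mulr1; rewrite mu1.
apply: le_trans (expR_ge1Dx _).
apply: le_trans (_ : \sum_l (mu v l + t * (mu v l * x v l) + 2 * t ^+ 2 * mu v l) <= _);
  last by rewrite !big_split /= -!mulr_sumr mu1 mulr1 addrA.
apply: ler_sum => l _; have /andP[x0 x1] := x01 v l; have m0 := mu0 v l.
have tx : t * x v l <= 1/2 by nra.
have := expR_le_quadratic (mulr_ge0 t0 x0) tx => he.
apply: le_trans (ler_wpM2l m0 he) _.
have : (t * x v l) ^+ 2 <= t ^+ 2 by rewrite ler_sqr ?nnegrE ?mulr_ge0 //; nra.
by move: (x v l) (mu v l) m0 {x0 x1 he tx}; set s := t ^+ 2 => y m m0 h; nra.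
Qed.

(** The local lemma is applied to the events [B u] that some sum at [u] is too large. Each shares
    coordinates with at most [D ^ 2] of them, while its probability decays exponentially in [D]. *)
Lemma labelling_near_mean (L K : finType) (eta : R) : 0 < eta ->
  exists D0 : nat, forall D : nat, (D0 <= D)%N ->
  forall (U V : finType) (N : U -> {set V}) (mu : V -> L -> R)
    (x : U -> K -> V -> L -> R),
  (forall v l, 0 <= mu v l) -> (forall v, \sum_l mu v l = 1) ->
  (forall u q v l, 0 <= x u q v l <= 1) ->
  (forall u, (#|N u| <= D)%N) -> (forall v, (#|[set u | v \in N u]| <= D)%N) ->
  exists2 lam : V -> L, forall u q,
    \sum_(v in N u) x u q v (lam v)
      <= \sum_(v in N u) \sum_l mu v l * x u q v l + eta * D%:R &
    forall v, mu v (lam v) != 0.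
Proof.
(* The cap at 1 ensures [t <= 1/2] for the parameter [t = e / 4] used below. *)
move=> eta0; pose e := Num.min eta 1.
have e0 : 0 < e by rewrite lt_min eta0 ltr01.
have e1 : e <= 1 by rewrite ge_min lexx orbT.
have ee : e <= eta by rewrite ge_min lexx.
(* For [t = e / 4] the exponent [2 * t ^+ 2 * D - t * e * D] equals [- c * D]. From [D >= b] follows
   [8 * #|K| * D ^ 2 <= (c * D) ^ 3 / 27], which the exponential dominates. *)
pose c := e ^+ 2 / 8; have c0 : 0 < c by rewrite divr_gt0 ?exprn_gt0.
pose b : R := 216 * #|K|%:R / c ^+ 3.
have b0 : 0 <= b by apply: divr_ge0; [exact: mulr_ge0|apply: exprn_ge0; exact: ltW].
exists (Num.bound b).+1 => D leD U V N mu x mu0 mu1 x01 ND multD.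
have Db : b <= D%:R.
  by apply: le_trans (ltW (archi_boundP b0)) _; rewrite ler_nat ltnW.
have D1 : 1 <= D%:R :> R by rewrite ler1n; apply: leq_trans leD.
pose B u := \bigcup_(q : K) [set f : {ffun V -> L} |
  \sum_(v in N u) \sum_l mu v l * x u q v l + e * D%:R < \sum_(v in N u) x u q v (f v)].
pose p := #|K|%:R * expR (- (c * D%:R)).
have pB u : prob mu (B u) <= p.
  apply: le_trans (prob_bigcup mu0 _ _) _; rewrite /p mulr_natl -sumr_const.
  apply: ler_sum => q _.
  apply: le_trans (@prob_exceed_mean _ _ _ _ _ (e / 4) _ mu0 mu1 (x01 u q) _ _) _; [lra|lra|].
  rewrite ler_expR /c.
  have : #|N u|%:R <= D%:R :> R by rewrite ler_nat.
  move: (#|N u|%:R) => n nD; have s0 : 0 <= e ^+ 2 by rewrite exprn_ge0 ?ltW.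
  have := ler_wpM2l s0 nD; lra.
have detB u : determined (N u) (B u).
  move=> f g fg.
  have E q : \sum_(v in N u) x u q v (f v) = \sum_(v in N u) x u q v (g v).
    by apply: eq_bigr => v vN; rewrite fg.
  by apply/bigcupP/bigcupP => -[q _ h]; exists q => //; move: h; rewrite !inE E.
have depB u : (#|[set i | ~~ [disjoint N i & N u]]| <= D ^ 2)%N.
  apply: leq_trans (_ : #|\bigcup_(v in N u) [set i | v \in N i]| <= _)%N.
    apply: subset_leq_card; apply/subsetP => i; rewrite inE => /pred0Pn[v /= /andP[vi vu]].
    by apply/bigcupP; exists v; rewrite ?inE.
  apply: leq_trans (_ : \sum_(v in N u) D <= _)%N.
    elim/big_ind2: _ => //; [by rewrite cards0|].
    by move=> A a B' b' hA hB; rewrite cardsU; apply: leq_trans (leq_subr _ _) (leq_add hA hB).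
  by rewrite sum_nat_const expnS expn1 leq_mul2r ND orbT.
have pd : 4 * p * (D ^ 2).+1%:R <= 1.
  rewrite /p expRN; set y := c * D%:R.
  have y0 : 0 <= y by rewrite mulr_ge0 // ltW.
  have ey : y ^+ 3 / 27 <= expR y.
    apply: le_trans (expR_ge1Dxn 2 y0).
    have : 0 <= y ^+ 3 by rewrite exprn_ge0.
    by move: (y ^+ 3) => y3; rewrite !factS fact0; lra.
  have y3 : 8 * #|K|%:R * D%:R ^+ 2 <= y ^+ 3 / 27.
    rewrite /y exprMn.
    have : 216 * #|K|%:R <= D%:R * c ^+ 3 by move: Db; rewrite /b ler_pdivrMr ?exprn_gt0.
    set c3 := c ^+ 3; set d := (D%:R : R); set kk := (#|K|%:R : R) => h.
    have -> : c3 * d ^+ 3 / 27 = (d * c3) / 27 * d ^+ 2 by ring.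
    by rewrite ler_pM2r ?exprn_gt0; lra.
  rewrite (_ : 4 * _ * _ = (4 * #|K|%:R * (D ^ 2).+1%:R) / expR y); last by ring.
  rewrite ler_pdivrMr ?expR_gt0 // mul1r; apply: le_trans ey; apply: le_trans y3.
  rewrite -[(D ^ 2).+1%:R]natr1 natrX.
  have : 0 <= #|K|%:R :> R by [].
  move: (#|K|%:R : R) => kk k0; have : 1 <= D%:R ^+ 2 :> R by rewrite exprn_ege1.
  by move: (D%:R ^+ 2 : R) => d2 hd; nra.
have [f hf f0] := local_lemma mu0 mu1 detB pB depB pd.
exists f => // u q; have := hf u; apply: contraNT; rewrite -ltNge => h.
apply/bigcupP; exists q => //; rewrite inE; apply: le_lt_trans h.
by rewrite lerD2l ler_wpM2r.
Qed.
End Concentration.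

(** * Edge colourings of bipartite graphs, greedy colouring *)

Section Konig.
Local Open Scope nat_scope.
Variables (A B : finType) (c : nat).
Implicit Types (E : {set A * B}) (col : A * B -> 'I_c).

Definition bip_proper E col := forall e f, e \in E -> f \in E -> e != f ->
  (e.1 == f.1) || (e.2 == f.2) -> col e != col f.

(** The edge [e] counts in the degree but is still uncoloured, so fewer than [c] colours occur at
    [x]. The projection [pr] covers both sides of the bipartition. *)
Lemma bip_free_colour (X : finType) E (pr : A * B -> X) (x : X) (e : A * B) col :
  e \notin E -> pr e = x -> (#|[set f in e |: E | pr f == x]| <= c)%N ->
  exists alpha : 'I_c, forall f, f \in E -> pr f = x -> col f != alpha.
Proof.
move=> eE ex dc; have : (#|col @: [set f in E | pr f == x]| < c)%N.
  apply: leq_ltn_trans (leq_imset_card _ _) _; apply: leq_trans dc.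
  apply: proper_card; apply/properP; split.
    by apply/subsetP => f; rewrite !inE => /andP[-> ->]; rewrite orbT.
  by exists e; rewrite !inE ?eqxx ?ex ?eqxx // (negbTE eE).
move=> lt; have /subsetPn[alpha _ h] : ~~ ([set: 'I_c] \subset col @: [set f in E | pr f == x]).
  by apply: contraL lt => /subset_leq_card; rewrite cardsT card_ord -leqNgt.
exists alpha => f fE fx; apply: contraNneq h => <-; apply: imset_f.
by rewrite inE fE fx eqxx.
Qed.


(* Kempe chains: when [al] is missing at [a] and [be] at [b], exchange [al] and
   [be] on the left vertices reached from [a] by alternately following a
   [be]-edge and an [al]-edge; bipartiteness keeps [b] out of the chain. *)
Lemma bip_kempe_step E col (a : A) (b : B) : (a, b) \notin E ->
  bip_proper E col ->
  (exists alpha : 'I_c, forall f, f \in E -> f.1 = a -> col f != alpha) ->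
  (exists beta : 'I_c, forall f, f \in E -> f.2 = b -> col f != beta) ->
  exists col', bip_proper ((a, b) |: E) col'.
Proof.
move=> abE pc [al ha] [be hb].
pose step (x x' : A) := [exists y : B, [&& (x, y) \in E, col (x, y) == be,
  (x', y) \in E & col (x', y) == al]].
pose X := connect step a.
pose sw (i : 'I_c) := if i == al then be else if i == be then al else i.
have swK : involutive sw.
  move=> i; rewrite /sw; have [->|ia] := eqVneq i al.
    by have [->|] := eqVneq be al => //; rewrite eqxx.
  by have [->|ib] := eqVneq i be; rewrite ?eqxx // (negbTE ia) (negbTE ib).
pose col1 (e : A * B) := if X e.1 then sw (col e) else col e.
pose col' e := if e == (a, b) then be else col1 e.
have Xa : X a by apply: connect0.
(* A chain reaching [x'] ends with the [al]-edge at [x'] and the [be]-edge at [y], both unique, so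
   it passes through [x]; the start [a] has no [al]-edge. Hence both edges are exchanged or neither
   is. *)
have al_in y x x' : (x, y) \in E -> (x', y) \in E -> col (x, y) = be -> col (x', y) = al ->
    X x = X x'.
  move=> e1 e2 c1 c2; apply/idP/idP => [h|].
    apply: connect_trans h (connect1 _); apply/existsP; exists y.
    by rewrite e1 e2 c1 c2 !eqxx.
  case/connectP => p; case/lastP: p => [|p z] /=.
    by move=> _ xa; have := ha _ e2 xa; rewrite c2 eqxx.
  rewrite rcons_path last_rcons => /andP[pth /existsP[y' /and4P[e3 /eqP c3 e4 /eqP c4]]] zx.
  subst z.
  have yy : y' = y.
    have := pc _ _ e4 e2; rewrite c4 c2 eqxx /= => h; apply/eqP/contraT => ny.
    by apply: h; rewrite ?xpair_eqE eqxx.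
  subst y'; have -> : x = last a p.
    have := pc _ _ e1 e3; rewrite c1 c3 eqxx /= => h; apply/eqP/contraT => nx.
    by apply: h; rewrite ?xpair_eqE eqxx ?andbT ?orbT.
  by apply/connectP; exists p.
have pc1 : bip_proper E col1.
  move=> [x1 y1] [x2 y2] e1 e2 ne inc.
  have := pc _ _ e1 e2 ne inc; rewrite /col1 /=.
  case/orP: inc => /= /eqP ?; subst; first by case: (X x2); rewrite // (inj_eq (inv_inj swK)).
  case h1: (X x1); case h2: (X x2) => // nc; rewrite ?(inj_eq (inv_inj swK)) //.
    apply/eqP => cc; move: cc nc; rewrite /sw; case: eqP => [c1 c2|n1].
      by rewrite (al_in y2 x2 x1) ?h1 // in h2.
    case: eqP => [c1 c2|n2 ->]; last by rewrite eqxx.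
    by rewrite -(al_in y2 x1 x2) ?h1 // in h2.
  apply/eqP => cc; move: cc nc; rewrite /sw; case: eqP => [c1 c2|n1].
    by rewrite -(al_in y2 x1 x2) ?h1 // in h2.
  case: eqP => [c1 c2|n2 ->]; last by rewrite eqxx.
  by rewrite (al_in y2 x2 x1) ?h1 // in h2.
have fa x y : (x, y) \in E -> x = a -> col1 (x, y) != be.
  move=> e xa; rewrite /col1 /= xa Xa; have := ha _ e xa; rewrite xa /sw => /negbTE ->.
  case: ifP => [/eqP <-|/negbT //]; have := ha _ e xa; rewrite xa => h.
  by rewrite eq_sym.
(* A vertex of [X] joined to [b] by an [al]-edge would have been reached through a [be]-edge at [b],
   and there is none. *)
have fb x y : (x, y) \in E -> y = b -> col1 (x, y) != be.
  move=> e yb; have hbe := hb _ e yb; rewrite /col1 /=; case: ifP => // Xx.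
  rewrite /sw (negbTE hbe); case: ifP => // /eqP cal.
  case/connectP: Xx => p; case/lastP: p => [|p z] /=.
    by move=> _ xa; have := ha _ e xa; rewrite cal eqxx.
  rewrite rcons_path last_rcons => /andP[pth /existsP[y' /and4P[e3 /eqP c3 e4 /eqP c4]]] zx.
  subst z; have yy : y' = y.
    have := pc _ _ e4 e; rewrite c4 cal eqxx /= => h; apply/eqP/contraT => ny.
    by apply: h; rewrite ?xpair_eqE eqxx.
  by subst y'; have := hb _ e3 yb; rewrite c3 eqxx.
exists col' => e f; rewrite !in_setU1 /col'.
have [-> _|ne /= eE] := eqVneq e (a, b); have [-> _|nf /= fE] := eqVneq f (a, b) => //=.
- by case: f fE nf => x y fE nf _ /orP[] /eqP; rewrite /= eq_sym => h; [apply: fa|apply: fb].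
- by case: e eE ne => x y eE ne _ /orP[] /eqP h; [apply: fa|apply: fb].
- exact: pc1.
Qed.

Lemma konig_edge_colouring E :
  (forall a, (#|[set e in E | e.1 == a]| <= c)%N) ->
  (forall b, (#|[set e in E | e.2 == b]| <= c)%N) ->
  'I_c -> exists col, bip_proper E col.
Proof.
move=> + + i0; have [n] := ubnP #|E|; elim: n E => // n IHn E ltE dA dB.
have [->|[[a b] abE]] := set_0Vmem E.
  by exists (fun=> i0) => e f; rewrite inE.
have subE (P : pred (A * B)) : (#|[set e in E :\ (a, b) | P e]| <= #|[set e in E | P e]|)%N.
  by apply: subset_leq_card; apply/subsetP => e; rewrite !inE => /andP[/andP[_ ->] ->].
have [|||col pc] := IHn (E :\ (a, b)).
- by move: ltE; rewrite (cardsD1 (a, b) E) abE ltnS.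
- by move=> x; apply: leq_trans (subE _) (dA x).
- by move=> x; apply: leq_trans (subE _) (dB x).
have nin : (a, b) \notin E :\ (a, b) by rewrite !inE eqxx.
rewrite -(setD1K abE); apply: bip_kempe_step pc _ _ => //.
  by apply: bip_free_colour nin _ _; rewrite ?setD1K.
by apply: bip_free_colour nin _ _; rewrite ?setD1K.
Qed.
End Konig.

Lemma greedy_colouring (X : finType) (r : rel X) (d : nat) :
  symmetric r -> irreflexive r -> (forall x, (#|[set y | r x y]| <= d)%N) ->
  exists col : X -> 'I_d.+1, forall x y, r x y -> col x != col y.
Proof.
move=> rsym rirr deg.
suff H n (Y : {set X}) : (#|Y| < n)%N -> exists col : X -> 'I_d.+1,
    forall x y, x \in Y -> y \in Y -> r x y -> col x != col y.
  have [col h] := H _ [set: X] (leqnn _); exists col => x y; exact: h.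
elim: n Y => // n IHn Y ltY; have [->|[x xY]] := set_0Vmem Y.
  by exists (fun=> ord0) => x y; rewrite inE.
have [|col h] := IHn (Y :\ x); first by move: ltY; rewrite (cardsD1 x Y) xY ltnS.
have /subsetPn[al _ hal] : ~~ ([set: 'I_d.+1] \subset col @: [set y | r x y]).
  apply/negP => /subset_leq_card; rewrite cardsT card_ord => le.
  have := leq_trans (leq_trans le (leq_imset_card _ _)) (deg x); by rewrite ltnn.
exists (fun y => if y == x then al else col y) => y z yY zY ryz.
have [yx|yx] := eqVneq y x; have [zx|zx] := eqVneq z x.
- by move: ryz; rewrite yx zx rirr.
- by apply: contraNneq hal => ->; apply: imset_f; rewrite inE -yx.
- by apply: contraNneq hal => <-; apply: imset_f; rewrite inE rsym -zx.
- by apply: h; rewrite // !inE ?yx ?zx.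
Qed.

(** * Positions at one vertex *)

Section Nu.
Variables (R : realType) (k : nat).
Implicit Types (H : {set {set 'I_k}}) (w : {set 'I_k} -> R).

Lemma fractional_matching_le_nu H w : intersecting H ->
  fractional_matching H w -> \sum_(e in H) w e <= nu R k.
Proof.
move=> iH fw; apply: le_trans (_ : fractional_matching_number R H <= _).
  apply: ub_le_sup; last by exists w.
  exists #|H|%:R => _ [w' [w'01 _] ->].
  rewrite -sum1_card natr_sum; apply: ler_sum => e eH.
  by have /andP[] := w'01 e eH.
exact: (@le_bigmax_cond _ R _ 0 H (@intersecting _) (fun H => fractional_matching_number R H) iH).
Qed.

(** Witnesses strictly below the supremum take the place of a maximiser; [lower_bound] recovers the
    exact constant by integrality. *)
Lemma fractional_matching_near_nu (a : R) : (0 < k)%N -> a < nu R k ->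
  exists H w, [/\ intersecting H, fractional_matching H w & a < \sum_(e in H) w e].
Proof.
(* The default value 0 of the maximum comes from no particular hypergraph, so negative [a] is served
   by the empty one. *)
move=> k0 anu; have [a0|a0] := ltP a 0.
  exists set0, (fun=> 0); split; last by rewrite big_set0.
  - by apply/forall_inP => e; rewrite inE.
  - by split=> [e|v]; rewrite ?inE // big1 // => e; rewrite inE.
have [H /andP[iH aH]] : exists H : {set {set 'I_k}},
    intersecting H && (a < fractional_matching_number R H).
  apply/existsP; apply: contraLR anu => /existsPn h; rewrite -leNgt.
  apply/bigmax_leP; split => // H iH; have := h H.
  by rewrite iH /= -leNgt.
have ne : classical_sets.nonempty
    [set s : R | exists2 w, fractional_matching H w & s = \sum_(e in H) w e]%classic.
  exists 0, (fun=> 0); last by rewrite big1.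
  by split=> [e|v]; rewrite ?lexx ?ler01 // big1.
have [_ [w fw ->] ltw] := sup_gt ne aH.
by exists H, w.
Qed.
End Nu.

(** * Merging disjoint types *)

Section Merging.
Variables (k : nat).
Implicit Types (S : {set 'I_k}) (F : {set {set 'I_k}}) (s : seq {set {set 'I_k}}).

Lemma trivIsetU_disjoint F F' : trivIset F -> trivIset F' ->
  cover F :&: cover F' = set0 -> trivIset (F :|: F').
Proof.
move=> /trivIsetP tF /trivIsetP tF' dF.
have dis S S' : S \in F -> S' \in F' -> [disjoint S & S'].
  move=> SF SF'; rewrite -setI_eq0 -subset0 -dF; apply: setISS; exact: bigcup_sup.
apply/trivIsetP => S S'; rewrite !inE => /orP[h1|h1] /orP[h2|h2] nS.
- exact: tF.
- exact: dis.
- by rewrite disjoint_sym; apply: dis.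
- exact: tF'.
Qed.

(** An entry of [s] is one group of merged edges, stored as the family of their types rather than
    its union, so that the types using it can be read off. *)
Let admissible (n : {set 'I_k} -> nat) s := all (fun F => trivIset F && (set0 \notin F)) s
  && [forall S, count (fun F => S \in F) s == n S].

(** Take a shortest admissible list: merging two distinct families with disjoint unions, or deleting
    an empty family, would shorten it. Equal families may repeat; they become multiplicities. *)
Lemma merge_disjoint_families (n : {set 'I_k} -> nat) : n set0 = 0%N ->
  exists s, [/\ {in s, forall F, trivIset F /\ set0 \notin F},
    forall S, count (fun F => S \in F) s = n S,
    {in s, forall F, F != set0} &
    {in s &, forall F F', F != F' -> cover F :&: cover F' != set0}].
Proof.
move=> n0.
have ex0 : exists m, exists s, admissible n s /\ size s = m.
  pose s := flatten [seq nseq (n X) [set X] | X <- enum {: {set 'I_k}}].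
  exists (size s), s; split=> //; apply/andP; split.
    apply/allP => F /flattenP[_ /mapP[S _ ->]]; rewrite mem_nseq => /andP[nS /eqP ->].
    rewrite trivIset1 inE /=; apply: contraTneq nS => <-; by rewrite n0.
  apply/forallP => S; rewrite /s count_flatten -map_comp sumnE big_map big_enum /=.
  rewrite (bigD1 S) //= count_nseq inE eqxx mul1n big1 ?addn0 // => S' nS.
  by rewrite count_nseq inE eq_sym (negbTE nS).
have ex0' : exists m, [exists s : m.-tuple {set {set 'I_k}}, admissible n s].
  case: ex0 => m [s [gs /eqP szs]]; exists m; apply/existsP; by exists (Tuple szs).
case: (ex_minnP ex0') => m /existsP[t gt] mmin.
have small s : admissible n s -> (m <= size s)%N.
  by move=> gs; apply: mmin; apply/existsP; exists (in_tuple s).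
move: (size_tuple t) gt; case: t => s _ /= szs gs.
have /andP[/allP gF /forallP cS] := gs.
exists s; split.
- by move=> F /gF /andP.
- by move=> S; apply/eqP.
- move=> F Fs; apply: contraTneq (leqnn m) => F0; rewrite -ltnNge.
  have pF := perm_to_rem Fs.
  suff : admissible n (rem F s).
    by move=> /small; rewrite size_rem // szs; move: Fs szs; case: (s) => //= *; lia.
  apply/andP; split; first by apply/allP => F' /mem_rem; apply: gF.
  by apply/forallP => S; rewrite -(eqP (cS S)) (permP pF) /= F0 inE.
- move=> F F' Fs F's nF; apply: contraTneq (leqnn m) => dF; rewrite -ltnNge.
  have F'r : F' \in rem F s.
    by move: F's; rewrite (perm_mem (perm_to_rem Fs)) inE eq_sym (negbTE nF).
  have pF := perm_to_rem Fs; have pF' := perm_to_rem F'r.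
  have /andP[tF eF] := gF _ Fs; have /andP[tF' eF'] := gF _ F's.
  suff /small : admissible n (F :|: F' :: rem F' (rem F s)).
    move=> h; apply: leq_ltn_trans h _; rewrite -szs (perm_size pF).
    by rewrite [size (F :: _)]/= (perm_size pF').
  apply/andP; split.
    rewrite /= trivIsetU_disjoint // inE negb_or eF eF' /=.
    by apply/allP => G /mem_rem /mem_rem; apply: gF.
  apply/forallP => S; rewrite -(eqP (cS S)) (permP pF) /= (permP pF') /= inE addnA eqn_add2r.
  case SF: (S \in F) => //=; case SF': (S \in F') => //=.
  (* A type in both families would lie in the intersection of the covers and be empty, so merging
     loses no count. *)
  have : S \subset cover F :&: cover F' by rewrite subsetI !bigcup_sup.
  by rewrite dF subset0 => /eqP S0; rewrite -S0 SF in eF.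
Qed.

(** Let [m e] count the families with union [e]. A family whose union contains [i] has a member
    containing [i], so the vertex sums of [m] are at most those of [n], and [m / D] is a fractional
    matching of the intersecting hypergraph of unions. *)
Lemma size_intersecting_families (R : realType) (n : {set 'I_k} -> nat) (D : nat) s :
  {in s, forall F, set0 \notin F} ->
  (forall S, count (fun F => S \in F) s = n S) ->
  {in s, forall F, F != set0} ->
  {in s &, forall F F', F != F' -> cover F :&: cover F' != set0} ->
  (forall i, (\sum_(S : {set 'I_k} | i \in S) n S <= D)%N) -> (0 < D)%N ->
  (size s)%:R <= nu R k * D%:R.
Proof.
move=> nF cS eF iF nD D0.
pose H : {set {set 'I_k}} := [set e | has (fun F => cover F == e) s].
pose m e := count (fun F => cover F == e) s.
have m_out e : e \notin H -> m e = 0%N.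
  by rewrite inE => h; apply/eqP; rewrite -leqn0 leqNgt -has_count.
have count_m (P : pred {set 'I_k}) : (\sum_(e in H | P e) m e = count (fun F => P (cover F)) s)%N.
  rewrite (eq_bigr (fun e => \sum_(F <- s) (cover F == e))%N); last first.
    by move=> e _; rewrite /m -sum1_count big_mkcond.
  rewrite exchange_big -sum1_count [RHS]big_mkcond /=.
  apply: eq_big_seq => F Fs; case: ifP => PF.
    rewrite (bigD1 (cover F)) ?PF ?andbT /=; last by rewrite inE; apply/hasP; exists F.
    by rewrite eqxx big1 // => e /andP[_]; rewrite eq_sym => /negbTE ->.
  rewrite big1 // => e /andP[_ Pe]; case: eqP => // ce; by rewrite -ce PF in Pe.
have sumi i : (\sum_(e in H | i \in e) m e <= D)%N.
  apply: leq_trans (nD i); rewrite (count_m (fun e => i \in e)).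
  under eq_bigr => S _ do rewrite -cS -sum1_count big_mkcond.
  rewrite exchange_big -sum1_count big_mkcond; apply: leq_sum => F _ /=.
  case: ifP => // /bigcupP[S SF iS]; by rewrite (bigD1 S) //= SF.
have nonempty e : e \in H -> exists i, i \in e.
  rewrite inE => /hasP[F Fs /eqP <-]; have /set0Pn[S SF] := eF _ Fs.
  have /set0Pn[i iS] : S != set0 by apply: contraNneq (nF _ Fs) => <-.
  by exists i; apply/bigcupP; exists S.
have D0' : 0 < D%:R :> R by rewrite ltr0n.
have iH : intersecting H.
  apply/forall_inP => e; rewrite inE => /hasP[F Fs /eqP <-].
  apply/forall_inP => f; rewrite inE => /hasP[F' Fs' /eqP <-].
  by apply/implyP => ne; apply: iF => //; apply: contraNneq ne => ->.
have sum_w i : \sum_(e in H | i \in e) (m e)%:R / D%:R <= 1 :> R.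
  by rewrite -mulr_suml ler_pdivrMr // mul1r -natr_sum ler_nat.
have fw : fractional_matching H (fun e => (m e)%:R / D%:R : R).
  split=> // e eH; rewrite divr_ge0 //=; have [i ie] := nonempty e eH.
  apply: le_trans (sum_w i); rewrite (bigD1 e) ?eH //= lerDl.
  by apply: sumr_ge0 => f _; rewrite divr_ge0.
have := fractional_matching_le_nu iH fw; rewrite -mulr_suml -natr_sum ler_pdivrMr //.
suff -> : size s = (\sum_(e in H) m e)%N by [].
rewrite -(count_predT s) -(count_m xpredT); apply: eq_bigl => e.
by rewrite andbT.
Qed.

(* Edges at a vertex, [d S] of them of type [S], are rounded up to multiples of
   [g]; a palette position is then a family of pairwise disjoint types. *)
Lemma local_palettes (R : realType) (d : {set 'I_k} -> nat) (Delta D g q : nat) :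
  (forall i, \sum_(S : {set 'I_k} | i \in S) d S <= Delta)%N ->
  (0 < D)%N -> (0 < g)%N -> (0 < q)%N -> (Delta + g * 2 ^ k <= g * D)%N ->
  nu R k * D%:R <= q%:R ->
  exists A : {set 'I_k} -> {set 'I_q}, [/\ forall S, A S != set0,
    forall S, S != set0 -> (d S <= g * #|A S|)%N &
    forall S S', (0 < d S)%N -> (0 < d S')%N -> S != S' -> S :&: S' != set0 ->
      A S :&: A S' = set0].
Proof.
move=> dD D0 g0 q0 DgD nuq.
(* [n S] is [d S / g] rounded up; this adds less than [g] for each of at most [2 ^ k] types, which
   [DgD] absorbs. *)
pose n S := if S == set0 then 0%N else ((d S + g.-1) %/ g)%N.
have dn S : S != set0 -> (d S <= g * n S)%N.
  move=> /negbTE nS; rewrite /n nS; have := ltn_ceil (d S + g.-1) g0; lia.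
have n0 : n set0 = 0%N by rewrite /n eqxx.
have nD i : (\sum_(S : {set 'I_k} | i \in S) n S <= D)%N.
  rewrite -(leq_pmul2l g0); apply: leq_trans DgD; rewrite big_distrr /=.
  apply: leq_trans (_ : \sum_(S : {set 'I_k} | i \in S) (d S + g) <= _)%N.
    apply: leq_sum => S _; rewrite /n; case: ifP => _; first by rewrite muln0.
    by have := leq_trunc_div (d S + g.-1) g; lia.
  rewrite big_split leq_add //= sum_nat_const mulnC leq_mul2l; apply/orP; right.
  have <- : #|powerset [set: 'I_k]| = (2 ^ k)%N by rewrite card_powerset cardsT card_ord.
  rewrite -cardsE; by apply: subset_leq_card; apply/subsetP => S _; rewrite powersetE subsetT.
have [s [gs cs es xs]] := merge_disjoint_families n0.
have szq : (size s <= q)%N.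
  rewrite -(ler_nat R); apply: le_trans nuq.
  by apply: (size_intersecting_families _ _ cs) => // F /gs[].
(* Absent types get all positions, so that a uniform choice from [A S] always makes sense. Positions
   beyond the end of [s] read the default [set0] and serve no other type. *)
pose A S := if (S == set0) || (d S == 0%N) then setT else [set a : 'I_q | S \in nth set0 s a].
have cardA S : #|[set a : 'I_q | S \in nth set0 s a]| = n S.
  have H m : (\sum_(a < m | S \in nth set0 s a) 1 = \sum_(0 <= a < m | S \in nth set0 s a) 1)%N.
    by rewrite big_mkord.
  rewrite -cs -sum1_count -sum1dep_card (big_nth set0) big_mkord /= !H.
  rewrite (big_cat_nat (leq0n _) szq) //= addnC big_nat_cond big1 // => i /andP[/andP[h _]].
  by rewrite nth_default // inE.
exists A; split.
- move=> S; rewrite /A; case: ifP => [_|/norP[S0 dS]].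
    by apply/set0Pn; exists (Ordinal q0).
  rewrite -card_gt0 cardA; have := dn _ S0; rewrite lt0n in dS *.
  by apply: contraTneq => ->; rewrite muln0 leqn0.
- move=> S S0; rewrite /A (negbTE S0) /=; case: eqP => [->//|_].
  by rewrite cardA dn.
- move=> S S' dS dS' nS mS; apply/eqP; rewrite -subset0; apply/subsetP => a.
  have S0 : S != set0 by apply: contraNneq mS => ->; rewrite set0I.
  have S0' : S' != set0 by apply: contraNneq mS => ->; rewrite setI0.
  rewrite /A (negbTE S0) (negbTE S0') /= !eqn0Ngt dS dS' !inE => /andP[aS aS'].
  have Fs : nth set0 s a \in s.
    by rewrite mem_nth // ltnNge; apply: contraTN aS => h; rewrite nth_default // inE.
  have [/trivIsetP tF _] := gs _ Fs; have := tF _ _ aS aS' nS.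
  by rewrite -setI_eq0 (negbTE mS).
Qed.
End Merging.

(** * Labels and choice of positions *)

Section RandomChoices.
Variables (R : realType) (k r q : nat).

Lemma sumr_mem_const (I : finType) (A : {set I}) (P : pred I) (a : R) :
  \sum_(i | P i) (if i \in A then a else 0) = #|[set i in A | P i]|%:R * a.
Proof.
rewrite -big_mkcondr /= mulr_natl -sumr_const.
by apply: eq_bigl => i; rewrite inE andbC.
Qed.

(** Given the labels, the left side is the expected number of [v] of type [S] and class [zeta] whose
    position, drawn uniformly from [A v S], is at offset [b] from the shift of [v]. Averaging over
    the class and the cyclic shift leaves [1 / (r.+1 * q.+1)] per [v], whatever the size of
    [A v S]. *)
Lemma palette_labels (eta : R) : 0 < eta ->
  exists D0 : nat, forall D : nat, (D0 <= D)%N ->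
  forall (T : finType) (tau : T -> T -> {set 'I_k}) (A : T -> {set 'I_k} -> {set 'I_q.+1}),
  (forall u v, tau u v = tau v u) -> (forall u S, A u S != set0) ->
  (forall u, (#|[set v | tau u v != set0]| <= D)%N) ->
  exists lam : T -> 'I_r.+1 * 'I_q.+1, forall u (S : {set 'I_k}) (zeta : 'I_r.+1) (b : 'I_q.+1),
    S != set0 ->
    \sum_(v | [&& tau u v == S, (lam v).1 == zeta & (lam v).2 + b \in A v S]) #|A v S|%:R^-1
      <= #|[set v | tau u v == S]|%:R / (r.+1%:R * q.+1%:R) + eta * D%:R.
Proof.
move=> eta0; pose L : finType := ('I_r.+1 * 'I_q.+1)%type.
pose K : finType := ({set 'I_k} * 'I_r.+1 * 'I_q.+1)%type.
have [D0 hD0] := labelling_near_mean L K eta0.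
exists D0 => D /hD0{}hD0 T tau A tauC A0 ND.
have Apos u S : 0 < #|A u S|%:R :> R by rewrite ltr0n card_gt0.
pose m : R := (r.+1%:R * q.+1%:R)^-1.
have rq0 : r.+1%:R * q.+1%:R != 0 :> R by rewrite mulf_neq0 // pnatr_eq0.
pose mu (v : T) (l : L) : R := m.
pose x (u : T) (t : K) (v : T) (l : L) : R :=
  if [&& tau u v == t.1.1, l.1 == t.1.2 & l.2 + t.2 \in A v t.1.1]
  then #|A v t.1.1|%:R^-1 else 0.
have [|||||lam hlam _] := hD0 _ _ (fun u => [set v | tau u v != set0]) mu x.
- by move=> v l; rewrite /mu /m invr_ge0 mulr_ge0.
- by move=> v; rewrite /mu sumr_const card_prod !card_ord -[m *+ _]mulr_natl natrM /m divff.
- move=> u t v l; rewrite /x; case: ifP => // _; last by rewrite lexx ler01.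
  by rewrite invr_ge0 ler0n invf_le1 ?Apos // ler1n card_gt0 A0.
- exact: ND.
- move=> v; rewrite (_ : finset _ = [set u | tau v u != set0]) //.
  by apply/setP => u; rewrite !inE tauC.
exists lam => u S zeta b S0; have := hlam u (S, zeta, b).
rewrite /x /= -big_mkcondr /=.
have -> : \sum_(v in [set v | tau u v != set0] | [&& tau u v == S, (lam v).1 == zeta &
    (lam v).2 + b \in A v S]) #|A v S|%:R^-1 = \sum_(v | [&& tau u v == S, (lam v).1 == zeta &
    (lam v).2 + b \in A v S]) #|A v S|%:R^-1 :> R.
  by apply: eq_bigl => v; rewrite inE; apply: andb_idl => /andP[/eqP ->].
move=> /le_trans; apply; rewrite lerD2r.
have -> : #|[set v | tau u v == S]|%:R / (r.+1%:R * q.+1%:R) =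
    \sum_(v in [set v | tau u v != set0]) (if tau u v == S then m else 0).
  rewrite -big_mkcondr /= sumr_const mulr_natl; congr (_ *+ _); apply: eq_card => v.
  rewrite inE unfold_in /= inE; apply/esym/andb_idl => /eqP ->; exact: S0.
apply: ler_sum => v _; rewrite -mulr_sumr /mu; case: eqP => tS /=; last by rewrite big1 ?mulr0.
rewrite -(pair_bigA _ (fun z y => if (z == zeta) && (y + b \in A v S) then #|A v S|%:R^-1 else 0)) /=.
rewrite (bigD1 zeta) //= [X in _ + X]big1 ?addr0; last first.
  by move=> z /negbTE ->; rewrite big1.
under eq_bigr do rewrite eqxx /=.
rewrite (reindex_inj (@addIr _ (- b))) /=.
under eq_bigr do rewrite subrK.
rewrite sumr_mem_const (_ : finset _ = A v S); last by apply/setP => y; rewrite inE andbT.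
by rewrite divff ?mulr1 // gt_eqF.
Qed.

Let flip (X : Type) (be : bool) (p : X * X) : X * X := if be then (p.2, p.1) else p.

Let flipK (X : Type) be : involutive (@flip X be).
Proof. by case: be => -[]. Qed.

(** Second round, with the labels fixed. Every ordered pair draws uniformly from the product of the
    palettes of its ends, and [sigma] reads the draw of the pair oriented by increasing [z], so both
    ends of an edge between classes use one draw. The flag [be] records that [u] is the second
    end. *)
Lemma edge_positions (eta : R) : 0 < eta ->
  exists D0 : nat, forall D : nat, (D0 <= D)%N ->
  forall (T : finType) (tau : T -> T -> {set 'I_k}) (A : T -> {set 'I_k} -> {set 'I_q.+1})
    (z : T -> 'I_r.+1) (y : T -> 'I_q.+1),
  (forall u v, tau u v = tau v u) -> (forall u S, A u S != set0) ->
  (forall u, (#|[set v | tau u v != set0]| <= D)%N) ->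
  exists sigma : T -> T -> 'I_q.+1,
    (forall u v, z u != z v -> sigma u v \in A u (tau u v)) /\
    forall u (S : {set 'I_k}) (zeta : 'I_r.+1) (s b : 'I_q.+1), S != set0 -> zeta != z u ->
      #|[set v | [&& tau u v == S, z v == zeta, sigma u v == s & sigma v u == y v + b]]|%:R
      <= (\sum_(v | [&& tau u v == S, z v == zeta & y v + b \in A v S]) #|A v S|%:R^-1)
           / #|A u S|%:R + eta * D%:R.
Proof.
move=> eta0; pose L : finType := ('I_q.+1 * 'I_q.+1)%type.
pose K : finType := (bool * {set 'I_k} * 'I_r.+1 * 'I_q.+1 * 'I_q.+1)%type.
(* Pairs containing [u] occur in both orders, so there are up to [2 * D] of them, compensated by
   half the error. *)
have eta2 : 0 < eta / 2 by lra.
have [D0 hD0] := labelling_near_mean L K eta2.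
exists D0.+1 => D leD T tau A z y tauC A0 ND.
have /hD0{}hD0 : (D0 <= 2 * D)%N by rewrite mul2n -addnn; apply: leq_trans (ltnW leD) (leq_addr _ _).
have D1 : (0 < D)%N by apply: leq_trans leD.
have Apos u S : 0 < #|A u S|%:R :> R by rewrite ltr0n card_gt0.
pose N u := [set p : T * T | ((p.1 == u) || (p.2 == u)) && (tau p.1 p.2 != set0)].
pose mu (p : T * T) (l : L) : R :=
  (if l.1 \in A p.1 (tau p.1 p.2) then #|A p.1 (tau p.1 p.2)|%:R^-1 else 0) *
  (if l.2 \in A p.2 (tau p.1 p.2) then #|A p.2 (tau p.1 p.2)|%:R^-1 else 0).
pose x (u : T) (t : K) (p : T * T) (l : L) : R :=
  let: (be, Y, zeta, s, b) := t in let p' := flip be p in let l' := flip be l in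
  ([&& p'.1 == u, tau p'.1 p'.2 == Y, z p'.2 == zeta, l'.1 == s & l'.2 == y p'.2 + b])%:R.
have [|||||lam hlam lam0] := hD0 _ _ N mu x.
- by move=> p l; rewrite /mu mulr_ge0 //; case: ifP => // _; rewrite invr_ge0.
- move=> p; rewrite /mu -(pair_bigA _ (fun a b : 'I_q.+1 =>
    (if a \in A p.1 (tau p.1 p.2) then #|A p.1 (tau p.1 p.2)|%:R^-1 else 0) *
    (if b \in A p.2 (tau p.1 p.2) then #|A p.2 (tau p.1 p.2)|%:R^-1 else 0))) /=.
  rewrite -big_distrlr /= !sumr_mem_const.
  have E (B : {set 'I_q.+1}) : [set i in B | true] = B by apply/setP => i; rewrite inE andbT.
  by rewrite !E !divff ?mulr1 // gt_eqF.
- by move=> u [[[[be S] zeta] s] b] p l; rewrite /x ler0n -[X in _ <= X]/(1%:R) ler_nat leq_b1.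
- move=> u; apply: leq_trans (_ : #|(fun v => (u, v)) @: [set v | tau u v != set0] :|:
      (fun v => (v, u)) @: [set v | tau u v != set0]| <= _)%N.
    apply: subset_leq_card; apply/subsetP => -[a b]; rewrite !inE /=.
    case/andP => /orP[/eqP -> t|/eqP -> t]; apply/orP; [left|right]; apply: imset_f; rewrite inE //.
    by rewrite tauC.
  rewrite cardsU mul2n -addnn; apply: leq_trans (leq_subr _ _) _; apply: leq_add;
    by apply: leq_trans (leq_imset_card _ _) (ND u).
- move=> p; apply: leq_trans (_ : #|[set p.1; p.2]| <= _)%N.
    apply: subset_leq_card; apply/subsetP => u; rewrite !inE => /andP[+ _].
    by rewrite ![_ == u]eq_sym.
  by rewrite cards2; apply: leq_trans (_ : 2 * 1 <= _)%N; [case: (_ != _)|rewrite leq_mul2l].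
pose sigma u v := (flip (~~ (z u < z v)%N) (lam (flip (~~ (z u < z v)%N) (u, v)))).1.
have muP p : (lam p).1 \in A p.1 (tau p.1 p.2) /\ (lam p).2 \in A p.2 (tau p.1 p.2).
  have := lam0 p; rewrite /mu; case: ifP; last by rewrite mul0r eqxx.
  by case: ifP; last by rewrite mulr0 eqxx.
exists sigma; split.
  move=> u v zuv; rewrite /sigma; case: (z u < z v)%N => /=; first by have [] := muP (u, v).
  by have [_] := muP (v, u); rewrite tauC.
move=> u S zeta s b S0 zu; pose be := ~~ (z u < zeta)%N.
have sumN (F : T * T -> R) : (forall p, (flip be p).1 != u -> F p = 0) ->
    (forall p, tau p.1 p.2 != S -> F p = 0) ->
    \sum_(p in N u) F p = \sum_v F (flip be (u, v)).
  move=> Fu FS; have -> : \sum_(p in N u) F p = \sum_p F p.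
    rewrite [RHS](bigID (mem (N u))) /= [X in _ = _ + X]big1 ?addr0 // => p pN.
    have [pu|/Fu //] := eqVneq (flip be p).1 u; apply: FS; apply: contraNneq pN => tS.
    rewrite inE tS S0 andbT -{1 2}pu; case: (be) => /=; by rewrite eqxx ?orbT.
  rewrite (reindex_inj (inv_inj (@flipK T be))).
  rewrite (eq_bigr (fun p => F (flip be (p.1, p.2)))); last by case.
  rewrite -(pair_bigA _ (fun a b => F (flip be (a, b)))) /=.
  rewrite (bigD1 u) //= [X in _ + X]big1 ?addr0 // => a au; apply: big1 => v _.
  by rewrite Fu // flipK.
have tau_flip p : tau (flip be p).1 (flip be p).2 = tau p.1 p.2.
  by case: (be) => //=; rewrite tauC.
have := hlam u (be, S, zeta, s, b).
rewrite (sumN (fun p => x u (be, S, zeta, s, b) p (lam p))); first last.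
- by move=> p nS; rewrite /x tau_flip (negbTE nS) andbF.
- by move=> p nu; rewrite /x (negbTE nu).
rewrite (sumN (fun p => \sum_l mu p l * x u (be, S, zeta, s, b) p l)); first last.
- by move=> p nS; rewrite big1 // => l _; rewrite /x tau_flip (negbTE nS) andbF mulr0.
- by move=> p nu; rewrite big1 // => l _; rewrite /x (negbTE nu) mulr0.
have -> : eta / 2 * (2 * D)%:R = eta * D%:R by rewrite natrM; field.
move=> hl.
rewrite -sum1_card natr_sum big_mkcond /=.
apply: le_trans (le_trans _ hl) _.
  rewrite le_eqVlt; apply/orP; left; apply/eqP; apply: eq_bigr => v _.
  rewrite /x flipK /= eqxx /= inE; case: eqP => //= _; case: eqP => //= zv.
  rewrite /sigma zv -/be.
  have -> : ~~ (zeta < z u)%N = ~~ be.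
    by rewrite /be negbK -leqNgt leq_eqVlt val_eqE eq_sym (negbTE zu).
  have -> : flip (~~ be) (v, u) = flip be (u, v) by case: (be).
  have -> : (flip (~~ be) (lam (flip be (u, v)))).1 = (flip be (lam (flip be (u, v)))).2.
    by case: (be); case: (lam _).
  by case: (_ && _).
rewrite lerD2r mulr_suml [leRHS]big_mkcond; apply: ler_sum => v _.
rewrite /x flipK /= eqxx /=; case: eqP => tS /=; last by rewrite big1 // => l _; rewrite mulr0.
case: eqP => zv /=; last by rewrite big1 // => l _; rewrite mulr0.
rewrite (bigD1 (flip be (s, y v + b))) //= flipK !eqxx /= mulr1 big1 ?addr0; last first.
  move=> l nl; case: andP => [[/eqP l1 /eqP l2]|]; last by rewrite mulr0.
  by case/eqP: nl; rewrite -[l](flipK be) -l1 -l2; case: (flip be l).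
have iA w S' : 0 <= #|A w S'|%:R^-1 :> R by rewrite invr_ge0.
rewrite /mu; case: (be) => /=; rewrite ?(tauC v) tS; case: ifP => // _; case: ifP => // _;
  by rewrite ?mul0r ?mulr0 ?mulr_ge0 // mulrC.
Qed.
End RandomChoices.

(** * Colouring block by block *)

Section BlockColouring.
Variables (k r q c delta : nat) (T : finType) (tau : T -> T -> {set 'I_k}).
Variables (z : T -> 'I_r.+1) (y : T -> 'I_q.+1) (sigma : T -> T -> 'I_q.+1).
Hypothesis tauC : forall u v, tau u v = tau v u.
Hypothesis tauuu : forall u, tau u u = set0.
Hypothesis sigma_disjoint : forall u v v', z u != z v -> z u != z v' ->
  tau u v :&: tau u v' != set0 -> sigma u v = sigma u v' -> tau u v = tau u v'.
Hypothesis block_degree : forall u (S : {set 'I_k}) (zeta : 'I_r.+1) (s b : 'I_q.+1),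
  S != set0 -> zeta != z u ->
  (#|[set v | [&& tau u v == S, z v == zeta, sigma u v == s & sigma v u == (y v + b)%R]]| <= c)%N.
Hypothesis leftover_degree : forall u,
  (#|[set v | (tau u v != set0) && (z v == z u)]| <= delta)%N.

(** Subtracting the shifts recovers the offsets [a] and [b]. Given [z u], the first component
    determines [z v], so in each block [u] is always the first end or always the second. *)
Let block (p : T * T) : 'I_r.+1 * 'I_q.+1 * 'I_q.+1 :=
  (z p.1 + z p.2, sigma p.1 p.2 - y p.1, sigma p.2 p.1 - y p.2).

Let block_edges phi S : {set T * T} :=
  [set p | [&& (z p.1 < z p.2)%N, block p == phi, tau p.1 p.2 == S & S != set0]].

(** The neighbours of [u] in one block and type lie in one class with both positions prescribed, so
    [block_degree] bounds their number. With [c.+1] colours the palette is inhabited even for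
    [c = 0]. *)
Let block_konig (x : ('I_r.+1 * 'I_q.+1 * 'I_q.+1) * {set 'I_k}) :
  exists col : T * T -> 'I_c.+1, bip_proper (block_edges x.1 x.2) col.
Proof.
case: x => -[[th a] b] S /=.
have bnd u (zeta : 'I_r.+1) s t (f : T -> T * T) (X : {set T * T}) :
    (forall e, e \in X -> S != set0 /\ exists v, e = f v /\
      [/\ zeta != z u, tau u v = S, z v = zeta, sigma u v = s & sigma v u = y v + t]) ->
    (#|X| <= c.+1)%N.
  move=> hX; have [->|[e eX]] := set_0Vmem X; first by rewrite cards0.
  have [S0 [v [_ [zu _ _ _ _]]]] := hX e eX.
  apply: leq_trans (leqnSn c); apply: leq_trans (block_degree s t S0 zu).
  apply: leq_trans (leq_imset_card f _); apply: subset_leq_card; apply/subsetP => e' /hX.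
  case=> _ [v' [-> [_ h1 h2 h3 h4]]]; apply: imset_f.
  by rewrite inE h1 h2 h3 h4 !eqxx.
apply: konig_edge_colouring ord0 => u.
  apply: (bnd u (th - z u) (a + y u) b (fun v => (u, v))) => -[u' v]; rewrite !inE /=.
  case/andP => /and4P[lt /eqP[<- <- <-] /eqP <- S0] /eqP uu; subst u'.
  split=> //; exists v; split=> //; rewrite [z u + _]addrC addrK subrK addrC subrK.
  by split=> //; apply: contraTneq lt => <-; rewrite ltnn.
apply: (bnd u (th - z u) (b + y u) a (fun v => (v, u))) => -[v u']; rewrite !inE /=.
case/andP => /and4P[lt /eqP[<- <- <-] /eqP <- S0] /eqP uu; subst u'.
split=> //; exists v; split=> //; rewrite addrK subrK addrC subrK tauC.
by split=> //; apply: contraTneq lt => <-; rewrite ltnn.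
Qed.

(** An edge inside a class meets at most [2 * delta] such edges, counting both ends, so they can be
    coloured greedily. Colouring two-element sets makes the result symmetric. *)
Let leftover_colouring : exists col : {set T} -> 'I_(2 * delta).+1,
  forall u v v', v != v' -> tau u v != set0 -> tau u v' != set0 -> z u = z v -> z u = z v' ->
    col [set u; v] != col [set u; v'].
Proof.
pose M : {set {set T}} := [set [set p.1; p.2] | p : T * T & (tau p.1 p.2 != set0) && (z p.2 == z p.1)].
pose conf (e f : {set T}) := [&& e != f, e :&: f != set0, e \in M & f \in M].
have csym : symmetric conf by move=> e f; rewrite /conf eq_sym setIC [(f \in M) && _]andbC.
have cirr : irreflexive conf by move=> e; rewrite /conf eqxx.
have inM u v : tau u v != set0 -> z u = z v -> [set u; v] \in M.
  by move=> t zz; apply/imsetP; exists (u, v); rewrite // inE /= t zz eqxx.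
pose B u := (fun v => [set u; v]) @: [set v | (tau u v != set0) && (z v == z u)].
have inB u (f : {set T}) : u \in f -> f \in M -> f \in B u.
  move=> uf /imsetP[[a b]]; rewrite inE /= => /andP[t /eqP zz] ef; move: uf; rewrite ef.
  rewrite !inE => /orP[] /eqP ->; apply/imsetP; first by exists b; rewrite // inE t zz eqxx.
  by exists a; rewrite ?inE 1?tauC ?t ?zz ?eqxx // setUC.
have Bd u : (#|B u| <= delta)%N by apply: leq_trans (leq_imset_card _ _) (leftover_degree u).
have cdeg (e : {set T}) : (#|[set f | conf e f]| <= 2 * delta)%N.
  have [eM|eM] := boolP (e \in M); last first.
    rewrite (_ : finset _ = set0) ?cards0 //; apply/setP => f; rewrite !inE /conf (negbTE eM).
    by rewrite !andbF.
  have /imsetP[[a b] _ ee] := eM; apply: leq_trans (_ : #|B a :|: B b| <= _)%N; last first.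
    rewrite cardsU mul2n -addnn; apply: leq_trans (leq_subr _ _) _; exact: leq_add.
  apply: subset_leq_card; apply/subsetP => f; rewrite inE => /and4P[_ /set0Pn[w] + _ fM].
  rewrite ee !inE => /andP[/orP[] /eqP -> wf]; apply/orP; [left|right]; exact: inB.
have [col colP] := greedy_colouring csym cirr cdeg.
exists col => u v v' nv t t' zz zz'; apply: colP; rewrite /conf !inM // !andbT.
have uv' : u != v' by apply: contraNneq t' => <-; rewrite tauuu.
have uv : u != v by apply: contraNneq t => <-; rewrite tauuu.
apply/andP; split; last by apply/set0Pn; exists u; rewrite !inE eqxx.
apply/eqP => /setP/(_ v); rewrite !inE eqxx orbT (negbTE nv) orbF.
by rewrite eq_sym (negbTE uv).
Qed.

(** All types in a block reuse the same [c.+1] colours: equally coloured edges at [u] use the same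
    position of [u], so by [sigma_disjoint] meeting types are equal, and within one type Koenig's
    colouring separates the edges. *)
Lemma block_colouring :
  exists (C : finType) (col : T -> T -> C),
    [/\ #|C| = (r.+1 * q.+1 * q.+1 * c.+1 + (2 * delta).+1)%N,
      forall u v, col u v = col v u &
      forall u v v', v != v' -> tau u v :&: tau u v' != set0 -> col u v != col u v'].
Proof.
have [kap kapP] := fin_all_exists block_konig.
have [lft lftP] := leftover_colouring.
pose c0 p : ('I_r.+1 * 'I_q.+1 * 'I_q.+1 * 'I_c.+1)%type :=
  (block p, kap (block p, tau p.1 p.2) p).
pose C : finType := (('I_r.+1 * 'I_q.+1 * 'I_q.+1 * 'I_c.+1) + 'I_(2 * delta).+1)%type.
have c0P p p' : inl (c0 p) = inl (c0 p') :> C -> [/\ z p.1 + z p.2 = z p'.1 + z p'.2,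
    sigma p.1 p.2 - y p.1 = sigma p'.1 p'.2 - y p'.1,
    sigma p.2 p.1 - y p.2 = sigma p'.2 p'.1 - y p'.2 &
    kap (block p, tau p.1 p.2) p = kap (block p', tau p'.1 p'.2) p'].
  move/eqP; rewrite -[_ == _]/(c0 p == c0 p') !xpair_eqE.
  by case/andP => /andP[/andP[/eqP ? /eqP ?] /eqP ?] /eqP ?.
exists C.
exists (fun u v => if (z u < z v)%N then inl (c0 (u, v)) else
  if (z v < z u)%N then inl (c0 (v, u)) else inr (lft [set u; v])).
split.
- by rewrite card_sum !card_prod !card_ord.
- move=> u v; case: ltngtP => // _; by rewrite setUC.
move=> u v v' nv tt.
have t0 : tau u v != set0 by apply: contraNneq tt => ->; rewrite set0I.
have t0' : tau u v' != set0 by apply: contraNneq tt => ->; rewrite setI0.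
have neqz w w' : (z w < z w')%N -> z w != z w' by move=> h; apply: contraTneq h => ->; rewrite ltnn.
have same_block w w' : z u + z w = z u + z w' -> z w = z w' by apply: addrI.
case: (ltngtP (z u) (z v)) => [uv|vu|/val_inj zz]; case: (ltngtP (z u) (z v')) => [uv'|v'u|/val_inj zz'] //.
- apply/eqP => /c0P[/= zv sv tv kk].
  have ts : tau u v = tau u v'.
    apply: sigma_disjoint => //; [exact: neqz|exact: neqz|exact: addIr sv].
  move: kk; rewrite /block /= zv sv tv -ts; apply/eqP.
  apply: (kapP (block (u, v'), tau u v)); rewrite ?inE /= ?uv ?uv' ?eqxx ?t0 ?ts ?andbT //=.
    by rewrite /block /= zv sv tv !eqxx.
  by rewrite xpair_eqE eqxx.
(* Equal first components force [z v = z v'], but [z u] lies strictly between the two. *)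
- by apply/eqP => /c0P[/= zv _ _ _]; move: uv v'u;
  rewrite (same_block v v') ?(addrC (z u) (z v')) // => h; rewrite ltnNge ltnW.
- by apply/eqP => /c0P[/= zv _ _ _]; move: vu uv';
  rewrite (same_block v v') ?(addrC (z u) (z v)) // => h; rewrite ltnNge ltnW.
- apply/eqP => /c0P[/= zv sv tv kk].
  have ts : tau u v = tau u v'.
    apply: sigma_disjoint => //; [by rewrite eq_sym; apply: neqz|by rewrite eq_sym; apply: neqz|exact: addIr tv].
  move: kk; rewrite /block /= zv sv tv !(tauC _ u) -ts; apply/eqP.
  apply: (kapP (block (v', u), tau u v));
    rewrite ?inE /= ?vu ?v'u ?eqxx ?t0 ?(tauC _ u) ?ts ?t0' ?eqxx ?andbT ?orbT //=.
    by rewrite /block /= zv sv tv !eqxx.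
  by rewrite xpair_eqE eqxx andbT.
- by have := lftP _ _ _ nv t0 t0' zz zz'; apply: contraNneq => -[->].
Qed.
End BlockColouring.

(** * Upper bound *)

Section TypedGraphs.
Variables (R : realType) (k : nat).
Hypothesis hk : (1 <= k)%N.

Lemma nu_ge0 : 0 <= nu R k.
Proof. exact: bigmax_ge_id. Qed.

Section Degrees.
Variables (T : finType) (tau : T -> T -> {set 'I_k}) (Delta : nat).
Hypothesis degD : forall u i, (#|[set v | i \in tau u v]| <= Delta)%N.

Lemma sum_type_degree u (P : pred {set 'I_k}) :
  (\sum_(S | P S) #|[set v | tau u v == S]| = #|[set v | P (tau u v)]|)%N.
Proof.
rewrite -[RHS]sum1dep_card (partition_big (tau u) P) //=; apply: eq_bigr => S PS.
by rewrite -sum1dep_card; apply: eq_bigl => v; rewrite andb_idl // => /eqP ->.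
Qed.

Lemma typed_degree_le u : (#|[set v | tau u v != set0]| <= k * Delta)%N.
Proof.
apply: leq_trans (_ : #|\bigcup_(i : 'I_k) [set v | i \in tau u v]| <= _)%N.
  apply: subset_leq_card; apply/subsetP => v; rewrite inE => /set0Pn[i iv].
  by apply/bigcupP; exists i; rewrite ?inE.
apply: leq_trans (_ : \sum_(i < k) Delta <= _)%N; last by rewrite sum_nat_const card_ord.
apply: (big_ind2 (fun (A : {set T}) a => #|A| <= a)%N) => //; first by rewrite cards0.
by move=> A a B b hA hB; rewrite cardsU; apply: leq_trans (leq_subr _ _) (leq_add hA hB).
Qed.
End Degrees.

(** Blocks times mean degree per block give [R0 * Q ^+ 2 * g / (R0 * Q) = Q * g], which is about
    [nk * Delta] because [g] is about [Delta / M] and [Q] about [nk * M]. The constants are fixed in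
    the order [M], [r], [eta], [Delta0], each making one error at most [e * Delta]. *)
Lemma typed_graph_colouring (eps : R) : 0 < eps ->
  exists Delta0 : nat, forall Delta : nat, (Delta0 <= Delta)%N ->
  forall (T : finType) (tau : T -> T -> {set 'I_k}),
    (forall u v, tau u v = tau v u) -> (forall u, tau u u = set0) ->
    (forall u i, (#|[set v | i \in tau u v]| <= Delta)%N) ->
  exists (C : finType) (col : T -> T -> C),
    [/\ #|C|%:R <= nu R k * Delta%:R + eps * Delta%:R,
      forall u v, col u v = col v u &
      forall u v v', v != v' -> tau u v :&: tau u v' != set0 -> col u v != col u v'].
Proof.
move=> eps0; pose nk := nu R k; have nk0 : 0 <= nk := nu_ge0.
pose e := eps / 4; have e0 : 0 < e by rewrite /e; lra.
pose K2 := (2 ^ k)%N.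
(* The extra [K2] in [D] pays for rounding the degrees of up to [2 ^ k] types; [M] is so large that
   [Q <= (nk + e) * M]. *)
pose M := (Num.bound ((nk * K2%:R + 1) / e)).+1; pose D := (M + K2)%N.
have M0 : 0 < M%:R :> R by rewrite ltr0n.
have hM : nk * K2%:R + 1 <= e * M%:R.
  rewrite [leRHS]mulrC -ler_pdivrMr //; apply: le_trans (ltW (archi_boundP _)) _.
    by rewrite divr_ge0 ?(ltW e0) // addr_ge0 // mulr_ge0.
  by rewrite ler_nat.
pose q := Num.truncn (nk * D%:R).
have /andP[hq1 hq2] : q%:R <= nk * D%:R < q.+1%:R.
  by apply: truncn_itv; rewrite mulr_ge0.
pose Q : R := q.+1%:R; have Q1 : 1 <= Q by rewrite ler1n.
pose r := Num.bound (2 * k%:R / e); pose R0 : R := r.+1%:R.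
have R01 : 1 <= R0 by rewrite ler1n.
have Qge0 : 0 <= Q by rewrite ler0n.
have Rge0 : 0 <= R0 by rewrite ler0n.
have hR0 : 2 * k%:R / R0 <= e.
  rewrite ler_pdivrMr ?(lt_le_trans ltr01) // [leRHS]mulrC -ler_pdivrMr //.
  apply: le_trans (ltW (archi_boundP _)) _; first by rewrite divr_ge0 ?(ltW e0) ?mulr_ge0.
  by rewrite ler_nat.
(* [E] gathers the factors of [eta]: the deviations of two rounds in each of the [R0 * Q ^+ 2]
   blocks, and twice the deviation of the leftover degree. *)
pose E : R := 2 * k%:R * R0 * Q ^+ 2 + 2 * K2%:R * Q * k%:R.
have E0 : 0 <= E by rewrite /E addr_ge0 // !mulr_ge0 ?exprn_ge0 // (le_trans ler01).
pose eta := e / (E + 1); have eta0 : 0 < eta by rewrite divr_gt0 //; lra.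
have hE : eta * E <= e.
  by rewrite /eta mulrAC ler_pdivrMr ?ler_pM2l //; lra.
have [D1 hD1] := palette_labels k r q eta0.
have [D2 hD2] := edge_positions k r q eta0.
pose F := (Q + R0 * Q ^+ 2 + 1) / e.
have F0 : 0 <= F.
  by rewrite divr_ge0 ?(ltW e0) // !addr_ge0 ?mulr_ge0 ?exprn_ge0 // (le_trans ler01).
exists (maxn (Num.bound F) (maxn D1 D2)) => Delta; rewrite !geq_max => /and3P[leF leD1 leD2].
move=> T tau tauC tauuu degD.
have hF : Q + R0 * Q ^+ 2 + 1 <= e * Delta%:R.
  rewrite [leRHS]mulrC -ler_pdivrMr //; apply: le_trans (ltW (archi_boundP F0)) _.
  by rewrite ler_nat.
have ledk : (Delta <= k * Delta)%N by rewrite leq_pmull.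
have ND := typed_degree_le degD.
pose g := (Delta %/ M).+1.
pose d u S := #|[set v | tau u v == S]|.
have hg : (Delta + g * K2 <= g * D)%N.
  rewrite mulnDr leq_add2r; have := ltn_ceil Delta (ltn0Sn (Num.bound ((nk * K2%:R + 1) / e))).
  by rewrite -/M /g => /ltnW.
have hg' : g%:R <= Delta%:R / M%:R + 1 :> R.
  rewrite -natr1 lerD2r ler_pdivlMr // -natrM ler_nat; exact: leq_trunc_div.
have hA u : exists Au : {set 'I_k} -> {set 'I_q.+1}, [/\ forall S, Au S != set0,
    forall S, S != set0 -> (d u S <= g * #|Au S|)%N &
    forall S S', (0 < d u S)%N -> (0 < d u S')%N -> S != S' -> S :&: S' != set0 ->
      Au S :&: Au S' = set0].
  apply: (@local_palettes k R (d u) Delta D g q.+1) => //; last exact: ltW.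
  move=> i; rewrite (sum_type_degree tau u (fun S => i \in S)); exact: degD.
have [A AP] := fin_all_exists hA.
have A0 u S : A u S != set0 by have [] := AP u.
have dA u S : S != set0 -> (d u S <= g * #|A u S|)%N by have [_ + _] := AP u; apply.
have [lam lamP] := hD1 _ (leq_trans leD1 ledk) T tau A tauC A0 ND.
pose z u := (lam u).1; pose y u := (lam u).2.
have [sigma [sigA sigP]] := hD2 _ (leq_trans leD2 ledk) T tau A z y tauC A0 ND.
pose kD : R := k%:R * Delta%:R; have kD0 : 0 <= kD by rewrite mulr_ge0.
have kDE : (k * Delta)%:R = kD by rewrite natrM.
(* The mean degree in a block plus one deviation for each of the two rounds. *)
pose cb : R := g%:R / (R0 * Q) + 2 * eta * kD.
have RQ0 : 0 < R0 * Q by rewrite mulr_gt0 // (lt_le_trans ltr01).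
have ekD0 : 0 <= eta * kD by apply: mulr_ge0 => //; apply: ltW.
have cb0 : 0 <= cb.
  apply: addr_ge0; first by apply: divr_ge0 => //; apply: ltW.
  by rewrite -mulrA; apply: mulr_ge0.
(* The mean leftover degree plus one deviation for each type and each offset. *)
pose db : R := kD / R0 + K2%:R * (Q * (eta * kD)).
have db0 : 0 <= db.
  by apply: addr_ge0; [exact: divr_ge0|do 2!apply: mulr_ge0 => //].
have /andP[hc _] := truncn_itv cb0; have /andP[hd _] := truncn_itv db0.
have [|||C [col [sC colC colP]]] :=
  @block_colouring k r q (Num.truncn cb) (Num.truncn db) T tau z y sigma tauC tauuu.
- move=> u v v' zv zv' mt ss; apply/eqP/contraT => nt.
  have [_ _ /(_ (tau u v) (tau u v'))] := AP u.
  have dpos w : (0 < d u (tau u w))%N by apply/card_gt0P; exists w; rewrite inE.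
  move=> /(_ (dpos _) (dpos _) nt mt) /setP/(_ (sigma u v)).
  by rewrite !inE sigA //= ss sigA.
- move=> u S zeta s b S0 zu; rewrite truncn_ge_nat //.
  apply: le_trans (sigP u S zeta s b S0 zu) _; rewrite kDE.
  have a1 : 1 <= #|A u S|%:R :> R by rewrite ler1n card_gt0.
  have a0 : 0 < #|A u S|%:R :> R by apply: lt_le_trans a1.
  have hl := lamP u S zeta b S0; rewrite -/(d u S) kDE -/R0 -/Q in hl.
  have hd' : (d u S)%:R <= g%:R * #|A u S|%:R :> R by rewrite -natrM ler_nat dA.
  apply: le_trans (_ : ((d u S)%:R / (R0 * Q) + eta * kD) / #|A u S|%:R + eta * kD <= _).
    by rewrite lerD2r ler_pM2r ?invr_gt0.
  rewrite /cb mulrDl.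
  (* Palette sizes proportional to degrees make this bound the same for all types. *)
  have h1 : (d u S)%:R / (R0 * Q) / #|A u S|%:R <= g%:R / (R0 * Q).
    by rewrite mulrAC ler_pM2r ?invr_gt0 // ler_pdivrMr.
  have h2 : eta * kD / #|A u S|%:R <= eta * kD.
    by rewrite ler_pdivrMr // ler_peMr // mulr_ge0 // ltW.
  have -> : 2 * eta * kD = eta * kD + eta * kD by ring.
  by rewrite addrA lerD2r; apply: lerD.
- move=> u; rewrite truncn_ge_nat //.
  pose B S := #|[set v | (tau u v == S) && (z v == z u)]|.
  (* Each [v] counted by [B S] contributes 1 to the sum of the loads over [b]. *)
  have hB S : S != set0 -> (B S)%:R <= (d u S)%:R / R0 + Q * (eta * kD).
    move=> S0; have -> : (B S)%:R = \sum_(b : 'I_q.+1)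
        \sum_(v | [&& tau u v == S, (lam v).1 == z u & (lam v).2 + b \in A v S]) #|A v S|%:R^-1 :> R.
      under eq_bigr do rewrite big_mkcond.
      rewrite exchange_big /= /B -sum1dep_card natr_sum big_mkcond; apply: eq_bigr => v _.
      rewrite -/(z v); case: eqP => tS /=; last by rewrite big1.
      case: eqP => zv /=; last by rewrite big1.
      rewrite (reindex_inj (@addrI _ (- y v))) /=.
      under eq_bigr do rewrite -/(y v) addNKr.
      rewrite sumr_mem_const (_ : finset _ = A v S); last by apply/setP => w; rewrite inE andbT.
      by rewrite divff // pnatr_eq0 -lt0n card_gt0.
    apply: le_trans (ler_sum _ (fun b _ => lamP u S (z u) b S0)) _.
    rewrite sumr_const card_ord -[X in X <= _]mulr_natl -/Q kDE -/R0 -/(d u S) mulrDr.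
    rewrite lerD2r le_eqVlt; apply/orP; left; apply/eqP; field.
    by rewrite !nat1r !pnatr_eq0.
  have -> : #|[set v | (tau u v != set0) && (z v == z u)]| = (\sum_(S | S != set0) B S)%N.
    rewrite -sum1dep_card (partition_big (tau u) (fun S => S != set0)) //=; last by move=> v /andP[].
    apply: eq_bigr => S S0; rewrite /B -sum1dep_card; apply: eq_bigl => v.
    by case: (tau u v =P S) => [->|_]; rewrite ?S0 ?andbT ?andbF.
  rewrite natr_sum; apply: le_trans (ler_sum _ hB) _.
  rewrite big_split /= -mulr_suml -natr_sum sum_type_degree; apply: lerD.
    by rewrite ler_pM2r ?invr_gt0 ?(lt_le_trans ltr01) // -kDE ler_nat.
  rewrite sumr_const -[leLHS]mulr_natl; apply: ler_wpM2r; first exact: mulr_ge0.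
  rewrite ler_nat /K2.
  have <- : #|powerset [set: 'I_k]| = (2 ^ k)%N by rewrite card_powerset cardsT card_ord.
  by rewrite -cardsE; apply: subset_leq_card; apply/subsetP => S _; rewrite powersetE subsetT.
exists C, col; split=> //; rewrite sC.
have Qg : Q * g%:R <= (nk + e) * Delta%:R + Q.
  apply: le_trans (_ : Q * (Delta%:R / M%:R + 1) <= _).
    by rewrite ler_pM2l // (lt_le_trans ltr01).
  rewrite mulrDr mulr1 lerD2r mulrCA [leRHS]mulrC ler_wpM2l // ler_pdivrMr //.
  rewrite /Q -natr1; have := hq1; rewrite /D natrD; lra.
have step : (r.+1 * q.+1 * q.+1 * (Num.truncn cb).+1 + (2 * Num.truncn db).+1)%:R
    <= R0 * Q * Q * (cb + 1) + (2 * db + 1) :> R.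
  rewrite natrD !natrM -/R0 -/Q -[(Num.truncn cb).+1%:R]natr1.
  rewrite -[(2 * Num.truncn db).+1%:R]natr1 natrM; apply: lerD; last first.
    by rewrite lerD2r ler_wpM2l.
  by apply: ler_wpM2l; [rewrite !mulr_ge0|rewrite lerD2r].
apply: le_trans step _.
have -> : R0 * Q * Q * (cb + 1) + (2 * db + 1) =
   Q * g%:R + eta * E * Delta%:R + 2 * k%:R / R0 * Delta%:R + (R0 * Q ^+ 2 + 1).
  have id (Qx Rx ex kx Kx gx Dx : R) : Qx != 0 -> Rx != 0 ->
      Rx * Qx * Qx * (gx / (Rx * Qx) + 2 * ex * (kx * Dx) + 1)
        + (2 * (kx * Dx / Rx + Kx * (Qx * (ex * (kx * Dx)))) + 1)
      = Qx * gx + ex * (2 * kx * Rx * Qx ^+ 2 + 2 * Kx * Qx * kx) * Dx + 2 * kx / Rx * Dx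
        + (Rx * Qx ^+ 2 + 1).
    by move=> Qx0 Rx0; field; rewrite Qx0 Rx0.
  by apply: id; rewrite pnatr_eq0.
have h1 : eta * E * Delta%:R <= e * Delta%:R by rewrite ler_wpM2r.
have h2 : 2 * k%:R / R0 * Delta%:R <= e * Delta%:R by rewrite ler_wpM2r.
have -> : eps = 4 * e by rewrite /e; field.
rewrite -/nk; move: Qg hF h1 h2.
move: (Q * g%:R) (eta * E * _) (2 * k%:R / R0 * _) (R0 * Q ^+ 2) => a1 a2 a3 a4; lra.
Qed.
End TypedGraphs.

(** * From simultaneous colourings to typed graphs *)

Lemma graph_edgeP (T : finType) (G : sgraph T) e u : e \in edges G -> u \in e ->
  exists2 v, u != v & e = [set u; v].
Proof.
move=> eG ue; have /forall_inP/(_ e eG)/andP[_ /cards2P[a [b [ab ee]]]] := edges_wf G.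
move: ue; rewrite ee !inE => /orP[] /eqP ->; first by exists b.
by exists a; rewrite 1?eq_sym // setUC.
Qed.

Lemma degree_le_max (T : finType) (G : sgraph T) u : (degree G u <= max_degree G)%N.
Proof.
have [uV|uV] := boolP (u \in vertices G).
  by rewrite /max_degree (bigD1 u) //= leq_maxl.
rewrite /degree (_ : finset _ = set0) ?cards0 //; apply/setP => e; rewrite !inE.
apply/negbTE/negP => /andP[eG ue]; have /forall_inP/(_ e eG)/andP[/subsetP/(_ u ue)] := edges_wf G.
by rewrite (negbTE uV).
Qed.

Lemma setU2_inj (T : finType) (u : T) : injective (fun v => [set u; v]).
Proof.
move=> v v' /setP E; have := E v; have := E v'; rewrite !inE !eqxx !orbT.
case: eqP => [->|_ /= /eqP //] _; rewrite orbb => /esym/eqP ->; reflexivity.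
Qed.

Lemma upper_bound (R : realType) (k : nat) (hk : (1 <= k)%N) (eps : R) : 0 < eps ->
    exists Delta0 : nat, forall Delta : nat, (Delta0 <= Delta)%N ->
    forall (T : finType) (G : 'I_k -> sgraph T),
      (forall i, (max_degree (G i) <= Delta)%N) ->
      (simultaneous_chromatic_index G)%:R
        <= nu R k * Delta%:R + eps * Delta%:R.
Proof.
move=> eps0; have [Delta0 h] := typed_graph_colouring hk eps0.
exists Delta0 => Delta /h{}h T G GD.
pose tau u v := [set i | [set u; v] \in edges (G i)].
have tauC u v : tau u v = tau v u by apply/setP => i; rewrite !inE setUC.
have tauuu u : tau u u = set0.
  apply/setP => i; rewrite !inE; apply/negP => uG.
  have /forall_inP/(_ _ uG)/andP[_] := edges_wf (G i).
  by rewrite setUid cards1.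
have [u i|C [col [sC colC colP]]] := h T tau tauC tauuu.
  apply: leq_trans (GD i); apply: leq_trans (degree_le_max (G i) u).
  rewrite -(card_imset _ (@setU2_inj _ u)) /degree; apply: subset_leq_card.
  by apply/subsetP => _ /imsetP[v + ->]; rewrite !inE eqxx => ->.
apply: le_trans sC; rewrite ler_nat /simultaneous_chromatic_index.
case: ex_minnP => n _; apply.
have /fin_all_exists[ce ceP] : forall e : union_edge G, exists x : C,
    forall u v, val e = [set u; v] -> x = col u v.
  move=> e; have /bigcupP[i _ ei] := valP e.
  have /forall_inP/(_ _ ei)/andP[_ /cards2P[a [b [ab ee]]]] := edges_wf (G i).
  exists (col a b) => u v; rewrite ee => /setP E.
  have := E a; have := E b; have := E u; have := E v; rewrite !inE !eqxx ?orbT /=.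
  move: ab; do ![case: eqP => //= ?; subst] => //.
apply/existsP; exists [ffun e => enum_rank (ce e)].
apply/forallP => i; apply/forallP => e; apply/forallP => f; apply/implyP.
case/and4P => ei fi nef /set0Pn[u]; rewrite inE => /andP[ue uf]; rewrite !ffunE.
have [v uv ev] := graph_edgeP ei ue; have [v' uv' fv'] := graph_edgeP fi uf.
rewrite (inj_eq enum_rank_inj) (ceP _ _ _ ev) (ceP _ _ _ fv'); apply: colP.
  by apply: contraNneq nef => vv; apply/eqP/val_inj; rewrite ev fv' vv.
by apply/set0Pn; exists i; rewrite !inE -ev -fv' ei fi.
Qed.

(** * Stars *)

Section SmallSupport.
Variables (R : realType) (k : nat).
Implicit Types (H : {set {set 'I_k}}) (w : {set 'I_k} -> R).

(** The incidence matrix has more rows than its [k] columns, so its left kernel is nonzero. *)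
Lemma incidence_dependency (P : {set {set 'I_k}}) : (k < #|P|)%N ->
  exists z : {set 'I_k} -> R, [/\ forall e, e \notin P -> z e = 0,
    exists2 e, e \in P & z e != 0 &
    forall v, \sum_(e in P | v \in e) z e = 0].
Proof.
move=> ltP; have [e0 e0P] : exists e, e \in P.
  by apply/set0Pn; rewrite -card_gt0; apply: leq_trans ltP.
pose A : 'M[R]_(#|P|, k) := \matrix_(i < #|P|, j < k) (j \in (enum_val i : {set 'I_k}))%:R.
have : kermx A != 0.
  rewrite -mxrank_eq0 mxrank_ker subn_eq0 -ltnNge.
  by apply: leq_ltn_trans ltP; apply: rank_leq_col.
case/rowV0Pn => z /sub_kermxP zA /rV0Pn[i zi].
exists (fun e => if e \in P then z 0 (enum_rank_in e0P e) else 0); split.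
- by move=> e /negbTE ->.
- by exists (enum_val i); rewrite ?enum_valP // enum_valK_in.
move=> v; have /matrixP/(_ 0 v) := zA; rewrite !mxE; apply: etrans.
rewrite (reindex_omap enum_val (fun e => Some (enum_rank_in e0P e))); last first.
  by move=> e /andP[eP _] /=; rewrite enum_rankK_in.
rewrite [RHS]big_mkcond [LHS]big_mkcond; apply: eq_bigr => j _.
rewrite enum_valP enum_valK_in eqxx andbT /= mxE.
by case: (v \in enum_val j); rewrite ?mulr1 ?mulr0 ?if_same.
Qed.

(** Induction on the support: moving along a dependency keeps all vertex sums, and with the right
    sign the size does not drop; stop when a weight reaches 0. Edges are nonempty, so the vertex
    sums keep the weights at most 1. *)
Lemma fractional_matching_small_support H w : set0 \notin H ->
  fractional_matching H w ->
  exists w', [/\ fractional_matching H w', \sum_(e in H) w e <= \sum_(e in H) w' e &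
    (#|[set e in H | w' e != 0%R]| <= k)%N].
Proof.
move=> H0; have [n] := ubnP #|[set e in H | w e != 0]|.
elim: n w => // n IHn w; rewrite ltnS => szn fw.
have [szk|ltk] := leqP #|[set e in H | w e != 0]| k; first by exists w; split.
have [z [zP [e0 e0P ze0] zv]] := incidence_dependency ltk.
wlog z0 : z zP ze0 zv / 0 <= \sum_(e in H) z e.
  move=> W; have [|lt0] := leP 0 (\sum_(e in H) z e); first exact: W.
  apply: (W (fun e => - z e)); rewrite ?oppr_eq0 //.
  - by move=> e /zP ->; rewrite oppr0.
  - by move=> v; rewrite sumrN zv oppr0.
  - by rewrite sumrN oppr_ge0 ltW.
have zvH v : \sum_(e in H | v \in e) z e = 0.
  apply: etrans (zv v); rewrite [LHS]big_mkcond [RHS]big_mkcond; apply: eq_bigr => e _.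
  have := zP e; rewrite !inE; case: (e \in H) => //=; case: (w e == 0) => //= ->; rewrite ?if_same //.
(* If no value were negative, the zero sum at a vertex of [e0] would force [z e0 = 0]. *)
have [e1 ze1] : exists e, z e < 0.
  have [lt0|ge0] := ltP (z e0) 0; first by exists e0.
  have e0H : e0 \in H by move: e0P; rewrite inE => /andP[].
  have /set0Pn[v ve0] : e0 != set0 by apply: contraNneq H0 => <-.
  apply/existsP; apply: contraT => /existsPn zge.
  have := zvH v; rewrite (bigD1 e0) ?e0H //= => /eqP.
  rewrite paddr_eq0 //; first by rewrite (negbTE ze0).
  by apply: sumr_ge0 => e _; rewrite leNgt.
(* The step length at which the weight of [e] reaches 0; the least one keeps all weights
   nonnegative. *)
pose t e := w e / - z e.
have [e2 ze2 tmin] := @arg_minP _ _ _ e1 (fun e => z e < 0) t ze1.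
have inP e : z e != 0 -> (e \in H) /\ w e != 0.
  by move=> h; have := contraNN (fun h' => introT eqP (zP e h')) h; rewrite negbK inE => /andP.
have [e2H we2] := inP _ (ltr0_neq0 ze2).
have [w01 wv] := fw.
have t0 : 0 <= t e2.
  by rewrite divr_ge0 ?oppr_ge0 ?(ltW ze2) //; have /andP[] := w01 _ e2H.
pose w1 e := w e + t e2 * z e.
have w1e2 : w1 e2 = 0 by rewrite /w1 /t; field; apply: ltr0_neq0.
have w1v v : \sum_(e in H | v \in e) w1 e <= 1.
  by rewrite /w1 big_split -mulr_sumr /= zvH mulr0 addr0.
have w1ge e : e \in H -> 0 <= w1 e.
  move=> eH; have /andP[we0 _] := w01 _ eH; rewrite /w1.
  have [zneg|zpos] := ltP (z e) 0; last by apply: addr_ge0 => //; apply: mulr_ge0.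
  have := tmin e zneg; rewrite {2}/t ler_pdivlMr ?oppr_gt0 //; lra.
have fw1 : fractional_matching H w1.
  split=> // e eH; rewrite w1ge //=.
  have /set0Pn[v ve] : e != set0 by apply: contraNneq H0 => <-.
  apply: le_trans (w1v v); rewrite (bigD1 e) ?eH //= lerDl; apply: sumr_ge0 => f /andP[/andP[fH _] _].
  exact: w1ge.
have [|w' [fw' le' sz']] := IHn w1 _ fw1.
  apply: leq_trans szn; apply: proper_card; apply/properP; split.
    apply/subsetP => e; rewrite !inE => /andP[-> /=]; apply: contraNneq => we.
    have [/eqP ze|ze] := boolP (z e == 0); first by rewrite /w1 ze we mulr0 addr0.
    by have [_] := inP _ ze; rewrite we eqxx.
  by exists e2; rewrite !inE ?e2H ?we2 // w1e2 eqxx andbF.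
exists w'; split=> //; apply: le_trans le'.
by rewrite /w1 big_split -mulr_sumr lerDl mulr_ge0.
Qed.
End SmallSupport.

(** * Stars with prescribed numbers of edges of each type *)

Section Stars.
Variables (T : finType) (c : T).

Lemma star_wf (X : {set T}) : [forall e in [set [set c; v] | v in ((c |: X) :\ c)%SET],
  (e \subset (c |: X)%SET) && (#|e| == 2)].
Proof.
apply/forall_inP => e /imsetP[v]; rewrite !inE => /andP[vc vX] ->.
rewrite cards2 (eq_sym c v) vc andbT; apply/subsetP => x; rewrite !inE => /orP[->//|/eqP ->].
by rewrite vX.
Qed.

Definition star (X : {set T}) := SGraph (star_wf X).

Lemma is_star_star (X : {set T}) : is_star c (star X).
Proof. by rewrite /is_star setU11 eqxx. Qed.

Lemma star_edgeE (X : {set T}) v : v != c -> ([set c; v] \in edges (star X)) = (v \in X).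
Proof.
move=> vc; apply/imsetP/idP => [[u]|vX].
  rewrite !inE => /andP[uc]; rewrite (negbTE uc) /= => uX /setP/(_ v).
  by rewrite !inE eqxx orbT (negbTE vc) /= => /esym/eqP ->.
by exists v => //; rewrite !inE vc vX orbT.
Qed.

Lemma card_star (X : {set T}) : c \notin X -> #|edges (star X)| = #|X|.
Proof.
move=> cX; rewrite card_in_imset.
  by rewrite setU1K.
move=> u v; rewrite !inE => /andP[uc _] /andP[vc _] /setP/(_ u).
by rewrite !inE eqxx orbT (negbTE uc) /= => /esym/eqP.
Qed.
End Stars.

Lemma card_ord_lt n m : (m <= n)%N -> #|[set j : 'I_n | (j < m)%N]| = m.
Proof. by move=> le; rewrite -sum1dep_card (big_ord_narrow le) sum1_card card_ord. Qed.

Section StarLowerBound.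
Variables (k : nat) (H : {set {set 'I_k}}) (d : {set 'I_k} -> nat) (Delta : nat).
Hypothesis H0 : set0 \notin H.
Hypothesis iH : intersecting H.
Hypothesis dD : forall i : 'I_k, (\sum_(e in H | i \in e) d e <= Delta)%N.

(* The leaf [Some (inl (S, j))] is joined to the centre [None] in exactly the
   stars of [S]; the leaves [Some (inr (i, j))] pad the [i]-th star. *)
Let T : finType := option (({set 'I_k} * 'I_Delta) + ('I_k * 'I_Delta))%type.

Let shared : {set {set 'I_k} * 'I_Delta} :=
  [set x : {set 'I_k} * 'I_Delta | (x.1 \in H) && (x.2 < d x.1)%N].
Let pad i := (Delta - \sum_(e in H | i \in e) d e)%N.
Let leaves (i : 'I_k) : {set T} := [set v : T | match v with
  | Some (inl x) => (x \in shared) && (i \in x.1)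
  | Some (inr y) => (y.1 == i) && (y.2 < pad i)%N
  | None => false end].
Let G (i : 'I_k) : sgraph T := star None (leaves i).

Let nonempty e : e \in H -> exists i, i \in e.
Proof. by move=> eH; apply/set0Pn; apply: contraNneq H0 => <-. Qed.

Let d_le e : e \in H -> (d e <= Delta)%N.
Proof.
move=> eH; have [i ie] := nonempty eH; apply: leq_trans (dD i).
by rewrite (bigD1 e) ?eH //= leq_addr.
Qed.

Let card_shared (P : pred {set 'I_k}) :
  #|[set x in shared | P x.1]| = (\sum_(e in H | P e) d e)%N.
Proof.
rewrite -sum1_card (eq_bigl (fun x : {set 'I_k} * 'I_Delta =>
  ((x.1 \in H) && P x.1) && (x.2 < d x.1)%N)); last first.
  by move=> x; rewrite !inE andbAC.
rewrite -(pair_big_dep (fun e => (e \in H) && P e) (fun e (j : 'I_Delta) => (j < d e)%N) (fun _ _ => 1%N)) /=.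
by apply: eq_bigr => e /andP[eH _]; rewrite sum1dep_card card_ord_lt ?d_le.
Qed.

Let card_leaves i : #|leaves i| = Delta.
Proof.
have -> : leaves i = (fun x => Some (inl x)) @: [set x in shared | i \in x.1]
    :|: (fun j : 'I_Delta => Some (inr (i, j))) @: [set j : 'I_Delta | (j < pad i)%N].
  apply/setP => -[[x|[i' j]]|]; rewrite !inE.
  - apply/idP/orP => [xi|[/imsetP[x' xi [->]]|/imsetP[]//]]; last by move: xi; rewrite !inE.
    by left; apply: imset_f; rewrite !inE in xi *.
  - apply/idP/orP => [/andP[/eqP /= -> h]|[/imsetP[]//|/imsetP[j']]].
      by right; apply: imset_f; rewrite inE.
    by rewrite inE => h [-> ->]; rewrite eqxx.
  - by apply/esym/negbTE; rewrite negb_or; apply/andP; split; apply/imsetP => -[].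
rewrite cardsU (_ : _ :&: _ = set0) ?cards0 ?subn0; last first.
  by apply/setP => v; rewrite !inE; apply/negbTE/negP => /andP[/imsetP[? _ ->] /imsetP[]].
rewrite !card_imset; [|by move=> ? ? []|by move=> ? ? []].
rewrite (card_shared (fun e => i \in e)) card_ord_lt ?leq_subr //.
by rewrite /pad subnKC.
Qed.

(** Edges to shared leaves conflict pairwise: their types have a common index, by [iH] if distinct
    and by nonemptiness if equal. Hence they all get different colours. *)
Lemma star_family_lower_bound :
  exists (T : finType) (c : T) (G : 'I_k -> sgraph T),
    (forall i, is_star c (G i) /\ #|edges (G i)| = Delta) /\
    (\sum_(e in H) d e <= simultaneous_chromatic_index G)%N.
Proof.
exists T, None, G; split=> [i|].
  by split; [exact: is_star_star|rewrite card_star ?card_leaves // inE].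
rewrite /simultaneous_chromatic_index; case: ex_minnP => n /existsP[col pcol] _.
pose edge (x : {set 'I_k} * 'I_Delta) : {set T} := [set None; Some (inl x)].
have edge_in i x : (edge x \in edges (G i)) = (x \in shared) && (i \in x.1).
  by rewrite /edge star_edgeE // inE.
have edge_union x : x \in shared -> edge x \in union_edges G.
  move=> xs; have := xs; rewrite inE => /andP[/nonempty[i ix] _].
  by apply/bigcupP; exists i => //; rewrite edge_in xs.
pose f x : option 'I_n := omap col (insub (edge x)).
have finj : {in shared &, injective f}.
  move=> x y xs ys; rewrite /f !insubT ?edge_union // => xu yu /= [cxy].
  apply/eqP; apply: contraT => nxy.
  have [i /andP[ix iy]] : exists i, (i \in x.1) && (i \in y.1).
    have := xs; rewrite inE => /andP[xH _]; have := ys; rewrite inE => /andP[yH _].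
    have [e|ne] := eqVneq x.1 y.1; first by have [i ix] := nonempty xH; exists i; rewrite -e ix.
    have /forall_inP/(_ _ xH)/forall_inP/(_ _ yH) := iH; rewrite ne => /set0Pn[i].
    by rewrite inE; exists i.
  have /forallP/(_ i)/forallP/(_ (Sub (edge x) yu))/forallP/(_ (Sub (edge y) xu)) := pcol.
  rewrite !SubK !edge_in xs ys ix iy cxy eqxx /= implybF negb_and negbK => /orP[/eqP|].
    move/(congr1 val); rewrite !SubK => /setP/(_ (Some (inl x))).
    by rewrite !inE eqxx /= => /esym/eqP[] xy; rewrite xy eqxx in nxy.
  by move/negPn/eqP/setP/(_ None); rewrite !inE.
have <- : #|shared| = (\sum_(e in H) d e)%N.
  have := card_shared xpredT; under [RHS]eq_bigl do rewrite andbT.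
  by move=> <-; apply: eq_card => x; rewrite !inE andbT.
rewrite -(card_in_imset finj).
apply: leq_trans (_ : #|[set Some i | i in 'I_n]| <= _)%N; last first.
  by rewrite card_imset ?card_ord // => ? ? [].
apply: subset_leq_card; apply/subsetP => _ /imsetP[x xs ->].
rewrite /f insubT ?edge_union // => xu /=; exact: imset_f.
Qed.
End StarLowerBound.

Lemma lower_bound (R : realType) (k : nat) (hk : (1 <= k)%N) (Delta : nat) : (0 < Delta)%N ->
  exists (T : finType) (c : T) (G : 'I_k -> sgraph T),
      (forall i, is_star c (G i) /\ #|edges (G i)| = Delta) /\
      nu R k * Delta%:R - k%:R <= (simultaneous_chromatic_index G)%:R.
Proof.
move=> D0; have D0' : 0 < Delta%:R :> R by rewrite ltr0n.
(* As [a * Delta = n0 - 1 + k], a matching larger than [a] leaves more than [n0 - 1] edges after a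
   rounding loss of at most [k], hence at least the integer [n0]. *)
pose n0 := Num.ceil (nu R k * Delta%:R - k%:R).
pose a : R := (n0%:~R - 1 + k%:R) / Delta%:R.
have anu : a < nu R k.
  rewrite /a ltr_pdivrMr //; have := gt_pred_ceil (nu R k * Delta%:R - k%:R).
  rewrite -/n0 => h; have : (n0 - 1)%:~R < nu R k * Delta%:R - k%:R :> R by [].
  rewrite intrB; lra.
(* An intersecting hypergraph with the empty edge has no other edge, so its matchings have size at
   most 1, and a single one-vertex edge does as well. *)
have [H [w [H0 iH fw aw]]] : exists (H : {set {set 'I_k}}) (w : {set 'I_k} -> R),
    [/\ set0 \notin H, intersecting H, fractional_matching H w & a < \sum_(e in H) w e].
  have [H [w [iH fw aw]]] := fractional_matching_near_nu hk anu.
  have [H0|H0] := boolP (set0 \in H); last by exists H, w; split.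
  have H1 : H = [set set0].
    apply/setP => e; rewrite inE; apply/idP/eqP => [eH|->//]; apply/eqP/contraT => ne.
    by have /forall_inP/(_ _ eH)/forall_inP/(_ _ H0) := iH; rewrite ne setI0 eqxx.
  exists [set [set Ordinal hk]], (fun=> 1); split.
  - by rewrite inE eq_sym; apply/set0Pn; exists (Ordinal hk); rewrite inE.
  - apply/forall_inP => e /set1P ->; apply/forall_inP => f /set1P ->; by rewrite eqxx.
  - split=> [e _|v]; rewrite ?ler01 ?lexx // sumr_const.
    rewrite -[leRHS]/(1%:R) ler_nat.
    apply: leq_trans (_ : #|[set [set Ordinal hk]]| <= 1)%N; last by rewrite cards1.
    by apply: subset_leq_card; apply/subsetP => e; rewrite unfold_in => /andP[].
  - rewrite big_set1; apply: lt_le_trans aw _; rewrite H1 big_set1.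
    by have [w01 _] := fw; have /andP[] := w01 _ H0.
have [w' [[w01 wv] lew szw]] := fractional_matching_small_support H0 fw.
pose d e := Num.truncn (w' e * Delta%:R).
have w0 e : e \in H -> 0 <= w' e * Delta%:R.
  by move=> eH; rewrite mulr_ge0 //; have /andP[] := w01 _ eH.
have dD (i : 'I_k) : (\sum_(e in H | i \in e) d e <= Delta)%N.
  rewrite -(ler_nat R) natr_sum.
  apply: le_trans (_ : (\sum_(e in H | i \in e) w' e) * Delta%:R <= _); last first.
    by rewrite ler_piMl // ltW.
  rewrite mulr_suml; apply: ler_sum => e /andP[eH _].
  by have /andP[] := truncn_itv (w0 _ eH).
have [T [c [G [sG le]]]] := star_family_lower_bound H0 iH dD.
exists T, c, G; split=> //.
apply: le_trans (ceil_ge _) _; rewrite -/n0.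
apply: le_trans (_ : (\sum_(e in H) d e)%:R <= _); last by rewrite ler_nat.
suff : (n0 - 1)%:~R < (Posz (\sum_(e in H) d e)%N)%:~R :> R.
  rewrite ltr_int ltrBlDr => h.
  by rewrite -[leRHS]/((Posz (\sum_(e in H) d e)%N)%:~R) ler_int -ltzD1.
rewrite intrB.
have : a * Delta%:R < (\sum_(e in H) w' e) * Delta%:R by rewrite ltr_pM2r //; lra.
rewrite /a divfK ?gt_eqF //.
(* Truncation loses at most 1 on each nonzero weight, and there are at most [k] of these. *)
have : (\sum_(e in H) w' e) * Delta%:R <= (\sum_(e in H) d e)%:R + k%:R.
  rewrite mulr_suml; apply: le_trans (_ : \sum_(e in H) ((d e)%:R + (w' e != 0)%:R) <= _).
    apply: ler_sum => e eH; rewrite /d; case: eqP => [->|_]; first by rewrite mul0r truncn0 addr0.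
    have /andP[_] := truncn_itv (w0 _ eH); rewrite -natr1 => h; exact: ltW.
  rewrite big_split -!natr_sum /= lerD2l ler_nat; apply: leq_trans szw.
  by rewrite -sum1dep_card [leqRHS]big_mkcondr; apply: leq_sum => e _; case: ifP.
rewrite -[X in _ -> _ -> _ < X]/((\sum_(e in H) d e)%:R : R); lra.
Qed.

Theorem theorem1p1 (R : realType) (k : nat) (hk : (1 <= k)%N) :
  (forall eps : R, 0 < eps ->
    exists Delta0 : nat, forall Delta : nat, (Delta0 <= Delta)%N ->
    forall (T : finType) (G : 'I_k -> sgraph T),
      (forall i, (max_degree (G i) <= Delta)%N) ->
      (simultaneous_chromatic_index G)%:R
        <= nu R k * Delta%:R + eps * Delta%:R)
  /\
  (forall Delta : nat, (0 < Delta)%N ->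
    exists (T : finType) (c : T) (G : 'I_k -> sgraph T),
      (forall i, is_star c (G i) /\ #|edges (G i)| = Delta) /\
      nu R k * Delta%:R - k%:R <= (simultaneous_chromatic_index G)%:R).
Proof.
split; first exact: upper_bound.
exact: lower_bound.
Qed.
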